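(* Let $X,Y,Z$ be reflexive Banach spaces, let $S_1:X\rightrightarrows Y$ and $S_2:Y\rightrightarrows Z$ be set-valued mappings, and let $\Omega\subset X$ be closed and convex. Let $S:=S_2\circ S_1:X\rightrightarrows Z$ and define $G:X\times Z\rightrightarrows Y$ by $G(x,z):=S_1(x)\cap S_2^{-1}(z)=\{y\in S_1(x)\mid z\in S_2(y)\}$. Fix $(\bar x,\bar z)\in\operatorname{gph}S|_\Omega$ and $\bar y\in G(\bar x,\bar z)$. Suppose that the graphs of $S_1$ and $S_2$ are locally closed around $(\bar x,\bar y)$ and $(\bar y,\bar z)$, respectively, and that $G$ is inner semicontinuous relative to $\Omega\times Z$ at $(\bar x,\bar z,\bar y)$. Then: (i) Assume that either $S_2$ is PSNC at $(\bar y,\bar z)$ or $S_1^{-1}$ is completely mirror PSNC relative to $\Omega$ at $(\bar y,\bar x)$, and that $$D^*S_2(\bar y|\bar z)(0)\cap\big(-D^{*-1}_\Omega S_1^{-1}(\bar y|\bar x)(0)\big)=\{0\}.$$ Then for all $z^*\in Z^*$, $$D^{c*}_\Omega S(\bar x|\bar z)(z^* )\subset\widetilde D^{c*}_\Omega S_1(\bar x|\bar y)\circ D^*S_2(\bar y|\bar z)(z^* ),$$ $$\widetilde D^{c*}_\Omega S(\bar x|\bar z)(z^* )\subset\widetilde D^{c*}_\Omega S_1(\bar x|\bar y)\circ\widetilde D^*S_2(\bar y|\bar z)(z^* ).$$ (ii) If $S_2:=f:Y\to Z$ is single-valued and strictly differentiable at $\bar y$, then $$D^{c*}_\Omega S(\bar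 x|\bar z)(z^* )\subset D^{c*}_\Omega S_1(\bar x|\bar y)\big(\nabla f(\bar y)^*z^*\big)\quad\text{for all }z^*\in Z^*.$$
   Context: Conventions: every reflexive Banach space is equipped with an equivalent norm such that both the space and its dual are locally uniformly convex and the norm is Fréchet differentiable at each nonzero point. Products carry the Euclidean norm $\|(x,y)\|=\sqrt{\|x\|^2+\|y\|^2}$ (similarly for more factors and duals). $\rightharpoonup^*$ is weak$^*$ sequential convergence; $\varepsilon_k\downarrow0$ means $\varepsilon_k\ge0$, $\varepsilon_k\to0$. For multifunctions, $(F_2\circ F_1)(u)=\bigcup_{v\in F_1(u)}F_2(v)$. $\operatorname{dom}F=\{u\mid F(u)\neq\emptyset\}$. $\nabla f(\bar y)^*$ is the adjoint of the derivative. For $F:X\rightrightarrows Y$ and $\Omega\subset X$, $\operatorname{gph}F|_\Omega=\{(x,y)\mid x\in\Omega,\ y\in F(x)\}$. Duality mapping: $J(x)=\{x^*\in X^*\mid\langle x^*,x\rangle=\|x\|^2,\ \|x^*\|=\|x\|\}$; $J(A)=\bigcup_{x\in A}J(x)$. Tangent (contingent) cone: $w\in T(\bar x;\Omega)$ iff there are $t_k>0$, $t_k\to0$, $w_k\to w$ with $\bar x+t_kw_k\in\Omega$ for all $k$. For $\varepsilon\ge0$, $\Lambda\subset U$ ($U$ Banach), $\bar u\in\Lambda$: $\widehat N^c_\varepsilon(\bar u;\Lambda)=\{u^*\in U^*\mid\limsup_{u\to\bar u,\,u\in\Lambda}\frac{\langle u^*,u-\bar u\rangle}{\|u-\bar u\|}\le\varepsilon\|u^*\|\}$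 (limsup over $u\ne\bar u$; vacuous if $\bar u$ is isolated in $\Lambda$). Conic normal contingent coderivative of $F:X\rightrightarrows Y$ relative to $\Omega\subset X$ at $(\bar x,\bar y)\in\operatorname{gph}F|_\Omega$: $x^*\in\widetilde D^{c*}_\Omega F(\bar x|\bar y)(y^* )$ iff there exist $\varepsilon_k\downarrow0$, $(x_k,y_k)\in\operatorname{gph}F|_\Omega$, $(x_k,y_k)\to(\bar x,\bar y)$, and $(x_k^*,-y_k^* )\in\widehat N^c_{\varepsilon_k}((x_k,y_k);\operatorname{gph}F|_\Omega)\cap[J(T(x_k;\Omega))\times Y^*]$ with $x_k^*\rightharpoonup^*x^*$ and $y_k^*\rightharpoonup^*y^*$. The conic mixed contingent coderivative $D^{c*}_\Omega F(\bar x|\bar y)$ is defined identically except that $y_k^*\to y^*$ strongly. Unconstrained notions for $S_2:Y\rightrightarrows Z$: $D^*S_2(\bar y|\bar z)$ and $\widetilde D^*S_2(\bar y|\bar z)$ are the usual mixed and normal coderivatives, i.e. the conic mixed and conic normal contingent coderivatives of $S_2$ with constraint set equal to the whole space $Y$: $y^*\in D^*S_2(\bar y|\bar z)(z^* )$ (resp. $\widetilde D^*S_2(\bar y|\bar z)(z^* )$) iff there are $\varepsilon_k\downarrow0$, $(y_k,z_k)\in\operatorname{gph}S_2$ converging to $(\bar y,\bar z)$, $(y_k^*,-z_k^* )\in\widehat N^c_{\varepsilon_k}((y_k,z_k);\operatorname{gph}S_2)$ with $y_k^*\rightharpoonup^*y^*$ and $z_k^*\to z^*$ strongly (resp. $z_k^*\rightharpoonup^*z^*$).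 $S_2$ is PSNC at $(\bar y,\bar z)$ if for all sequences $\varepsilon_k\downarrow0$, $(y_k,z_k)\to(\bar y,\bar z)$ in $\operatorname{gph}S_2$, $(y_k^*,-z_k^* )\in\widehat N^c_{\varepsilon_k}((y_k,z_k);\operatorname{gph}S_2)$ with $y_k^*\rightharpoonup^*0$, $z_k^*\to0$, one has $\|y_k^*\|\to0$. Mirror notions. Let $F:U\rightrightarrows V$ be a multifunction between Banach spaces, $\Theta\subset V$ nonempty, $\mathfrak F(u):=F(u)\cap\Theta$ and $(\bar u,\bar v)\in\operatorname{gph}\mathfrak F$. The complete mirror contingent coderivative $D^{*-1}_\Theta F(\bar u|\bar v):V^*\rightrightarrows U^*$ is defined by: $u^*\in D^{*-1}_\Theta F(\bar u|\bar v)(v^* )$ iff there exist $\varepsilon_k\downarrow0$, $(u_k,v_k)\in\operatorname{gph}\mathfrak F$ with $(u_k,v_k)\to(\bar u,\bar v)$, and $(u_k^*,-v_k^* )\in\widehat N^c_{\varepsilon_k}((u_k,v_k);\operatorname{gph}\mathfrak F)\cap[U^*\times J(T(v_k;\Theta))]$ with $u_k^*\rightharpoonup^*u^*$ and $v_k^*\to v^*$. $F$ is completely mirror PSNC relative to $\Theta$ at $(\bar u,\bar v)$ if for all sequences $\varepsilon_k\downarrow0$, $(u_k,v_k)\to(\bar u,\bar v)$ in $\operatorname{gph}\mathfrak F$, and $(u_k^*,-v_k^* )\in\widehat N^c_{\varepsilon_k}((u_k,v_k);\operatorname{gph}\mathfrak F)\cap[U^*\times J(T(v_k;\Theta))]$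 with $u_k^*\rightharpoonup^*0$ and $v_k^*\to0$, one has $\|u_k^*\|\to0$. In the theorem these are applied to $F=S_1^{-1}:Y\rightrightarrows X$ with $\Theta=\Omega\subset X$. Inner semicontinuity: $G:X\times Z\rightrightarrows Y$ is inner semicontinuous relative to $\Omega\times Z$ at $(\bar x,\bar z,\bar y)\in\operatorname{gph}G$ if for every sequence $(x_k,z_k)\to(\bar x,\bar z)$ in $\operatorname{dom}G\cap(\Omega\times Z)$ there are $y_k\in G(x_k,z_k)$ with $y_k\to\bar y$. *)

(* Defs.v *)
From HB Require Import structures.
From mathcomp Require Import all_boot all_order all_algebra.
From mathcomp Require Import ring lra.
From mathcomp Require Import all_classical all_reals all_analysis.

Set Implicit Arguments.
Unset Strict Implicit.
Unset Printing Implicit Defensive.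

Import Order.TTheory GRing.Theory Num.Theory.
Import numFieldNormedType.Exports.

Local Open Scope classical_set_scope.
Local Open Scope ring_scope.

Section Dual.
Variables (R : realType) (X : normedModType R).

Definition dual_pred : {pred X -> R^o} :=
  fun f => `[< linear f /\ continuous f >].

Record dual := Dual {
  dual_fun :> X -> R^o;
  dual_funP : dual_fun \in dual_pred }.

HB.instance Definition _ := [isSub for dual_fun].
HB.instance Definition _ := [Choice of dual by <:].

Lemma dual_pred_submod : submod_closed dual_pred.
Proof.
split.
  apply/asboolP; split=> [a u v|]; last exact: cst_continuous.
  by rewrite /= scaler0 addr0.
move=> a f g /asboolP[lf cf] /asboolP[lg cg]; apply/asboolP; split.
  by move=> b u v /=; rewrite !fctE lf lg /GRing.scale/=; ring.
move=> x; apply: continuousD; last exact: cg.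
by apply: continuousZr; exact: cf.
Qed.

HB.instance Definition _ :=
  GRing.isSubmodClosed.Build R (X -> R^o) dual_pred dual_pred_submod.
HB.instance Definition _ := [SubChoice_isSubLmodule of dual by <:].

Lemma dual_linear (f : dual) : linear f.
Proof. by case: f => f /= /asboolP[]. Qed.

HB.instance Definition _ (f : dual) :=
  GRing.isLinear.Build R X R^o _ (dual_fun f) (dual_linear f).

Lemma dual_continuous (f : dual) : continuous f.
Proof. by case: f => f /= /asboolP[]. Qed.

Lemma dualD (f g : dual) x : (f + g) x = f x + g x.
Proof. by []. Qed.

Lemma dualZ (a : R) (f : dual) x : (a *: f) x = a * f x.
Proof. by []. Qed.

Definition dual_norm (f : dual) : R :=
  sup [set `|f x| | x in [set x : X | `|x| <= 1]].

Lemma dual_norm_has_sup (f : dual) :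
  has_sup [set `|f x| | x in [set x : X | `|x| <= 1]].
Proof.
split; first by exists `|f 0|, 0 => //=; rewrite normr0.
have /linear_boundedP[y [yreal fr]] : bounded_near f (nbhs (0 : X)).
  by apply/linear_bounded_continuous; exact: dual_continuous.
exists (Num.max y 0 + 1) => _ [x /= x1 <-].
have y0 : 0 <= Num.max y 0 by rewrite le_max lexx orbT.
apply: (le_trans (fr (Num.max y 0 + 1) _ x)); last first.
  by rewrite ler_piMr// addr_ge0.
by rewrite (@le_lt_trans _ _ (Num.max y 0)) ?le_max ?lexx// ltrDl.
Qed.

Lemma dual_norm_ub (f : dual) x : `|x| <= 1 -> `|f x| <= dual_norm f.
Proof.
by move=> x1; apply: ub_le_sup; [case: (dual_norm_has_sup f)|exists x].
Qed.

Lemma dual_norm_le (f : dual) r :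
  (forall x, `|x| <= 1 -> `|f x| <= r) -> dual_norm f <= r.
Proof.
move=> fr; apply: ge_sup; first by case: (dual_norm_has_sup f).
by move=> _ [x x1 <-]; exact: fr.
Qed.

Lemma dual_norm_ge0 (f : dual) : 0 <= dual_norm f.
Proof. by apply: le_trans (@dual_norm_ub f 0 _) => //; rewrite normr0. Qed.

Lemma dual_normP (f : dual) x : `|f x| <= dual_norm f * `|x|.
Proof.
have [->|x0] := eqVneq x 0; first by rewrite linear0 !normr0 mulr0.
have nx : 0 < `|x| by rewrite normr_gt0.
have := @dual_norm_ub f (`|x|^-1 *: x).
rewrite normrZ normfV normr_id mulVf ?gt_eqF// => /(_ (lexx _)).
rewrite linearZ normrZ normfV normr_id mulrC.
by rewrite ler_pdivrMr.
Qed.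

Lemma dual_normD (f g : dual) :
  dual_norm (f + g) <= dual_norm f + dual_norm g.
Proof.
apply: dual_norm_le => x x1; rewrite dualD (le_trans (ler_normD _ _))//.
by rewrite lerD// dual_norm_ub.
Qed.

Lemma dual_normZ (a : R) (f : dual) : dual_norm (a *: f) = `|a| * dual_norm f.
Proof.
have leZ b g : dual_norm (b *: g) <= `|b| * dual_norm g.
  by apply: dual_norm_le => x x1; rewrite dualZ normrM ler_wpM2l// dual_norm_ub.
apply/eqP; rewrite eq_le leZ/=.
have [->|a0] := eqVneq a 0; first by rewrite normr0 mul0r dual_norm_ge0.
have := leZ a^-1 (a *: f); rewrite scalerA mulVf// scale1r normfV.
by rewrite ler_pdivlMl ?normr_gt0.
Qed.

Lemma dual_norm0_eq0 (f : dual) : dual_norm f = 0 -> f = 0.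
Proof.
move=> f0; apply/val_inj/funext => x /=.
by apply/eqP; rewrite -normr_le0 (le_trans (dual_normP f x))// f0 mul0r.
Qed.

HB.instance Definition _ :=
  Lmodule_isNormed.Build R dual dual_normD dual_normZ dual_norm0_eq0.

End Dual.

Arguments dual {R} X.

Section Geometry.
Variables (R : realType) (X : normedModType R).

(* surjectivity of the canonical embedding of X into its bidual *)
Definition reflexive_space : Prop :=
  forall F : dual (dual X), exists x : X, forall f : dual X, F f = f x.

Definition locally_uniformly_convex : Prop :=
  forall (x : X) (u : nat -> X), `|x| = 1 -> (forall k, `|u k| = 1) ->
    (fun k => `|x + u k|) @ \oo --> (2 : R) -> u @ \oo --> x.

Definition frechet_smooth_norm : Prop :=
  forall x : X, x != 0 -> differentiable (fun y : X => `|y| : R^o) x.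

Definition weak_star_cvg (f : nat -> dual X) (g : dual X) : Prop :=
  forall x : X, (fun k => f k x) @ \oo --> g x.

Definition duality_map (x : X) : set (dual X) :=
  [set f : dual X | f x = `|x| ^+ 2 /\ `|f| = `|x|].

Definition duality_image (A : set X) : set (dual X) :=
  \bigcup_(x in A) duality_map x.

Definition tangent_cone (Omega : set X) (x : X) : set X :=
  [set w : X | exists (t : nat -> R) (v : nat -> X),
    [/\ forall k, 0 < t k, t @ \oo --> (0 : R), v @ \oo --> w &
        forall k, Omega (x + t k *: v k)]].

Definition locally_closed_at (A : set X) (x : X) : Prop :=
  exists V : set X, [/\ nbhs x V, closed V & closed (A `&` V)].

End Geometry.

(* The standing convention on the norms: reflexivity comes with local uniform
   convexity of the space and of its dual, and Frechet smoothness. *)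
Definition renormed_reflexive (R : realType) (X : normedModType R) : Prop :=
  [/\ reflexive_space X, locally_uniformly_convex X,
      locally_uniformly_convex (dual X) & frechet_smooth_norm X].

Section Multifunctions.
Variables (U V : Type).
Implicit Type F : U -> set V.

Definition graph F : set (U * V) := [set p | F p.1 p.2].

Definition graph_on F (Omega : set U) : set (U * V) :=
  [set p | Omega p.1 /\ F p.1 p.2].

Definition mdom F : set U := [set u | F u !=set0].

Definition minv F : V -> set U := fun v => [set u | F u v].

Definition restrict_range F (Theta : set V) : U -> set V :=
  fun u => F u `&` Theta.

End Multifunctions.

Definition mcomp (U V W : Type) (F2 : V -> set W) (F1 : U -> set V) :
    U -> set W :=
  fun u => \bigcup_(v in F1 u) F2 v.

Definition intermediate (U V W : Type) (F1 : U -> set V) (F2 : V -> set W) :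
    U * W -> set V :=
  fun p => F1 p.1 `&` minv F2 p.2.

(* The library norm on a product is the max norm; the Euclidean one, which
   induces the same topology, has to be written out. *)
Definition l2norm (R : realType) (A B : normedModType R) (p : A * B) : R :=
  Num.sqrt (`|p.1| ^+ 2 + `|p.2| ^+ 2).

Section Normals.
Variables (R : realType) (U V : normedModType R).

(* The dual of U * V is identified with dual U * dual V. The filter is that of
   the punctured neighborhoods of w in L: if w is isolated in L, the limsup
   is -oo. *)
Definition eps_normal (eps : R) (L : set (U * V)) (w : U * V) :
    set (dual U * dual V) :=
  [set q : dual U * dual V | (limf_esup
      (fun u : U * V =>
        ((q.1 (u.1 - w.1) + q.2 (u.2 - w.2)) / l2norm (u - w))%:E)
      (within L w^') <= (eps * l2norm q)%:E)%E].

Definition normal_sequence (L : set (U * V)) (w : U * V) (eps : nat -> R)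
    (u : nat -> U * V) (f : nat -> dual U) (g : nat -> dual V) : Prop :=
  [/\ (forall k, 0 <= eps k) /\ eps @ \oo --> (0 : R),
      forall k, L (u k), u @ \oo --> w &
      forall k, eps_normal (eps k) L (u k) (f k, - g k)].

End Normals.

Section Coderivatives.
Variables (R : realType) (U V : normedModType R).

Definition conic_normal_coderiv (F : U -> set V) (Omega : set U) (w : U * V)
    (g : dual V) : set (dual U) :=
  [set f : dual U | exists eps u fs gs,
    [/\ normal_sequence (graph_on F Omega) w eps u fs gs,
        forall k, duality_image (tangent_cone Omega (u k).1) (fs k),
        weak_star_cvg fs f & weak_star_cvg gs g]].

Definition conic_mixed_coderiv (F : U -> set V) (Omega : set U) (w : U * V)
    (g : dual V) : set (dual U) :=
  [set f : dual U | exists eps u fs gs,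
    [/\ normal_sequence (graph_on F Omega) w eps u fs gs,
        forall k, duality_image (tangent_cone Omega (u k).1) (fs k),
        weak_star_cvg fs f & gs @ \oo --> g]].

Definition normal_coderiv (F : U -> set V) (w : U * V) (g : dual V) :
    set (dual U) :=
  [set f : dual U | exists eps u fs gs,
    [/\ normal_sequence (graph F) w eps u fs gs,
        weak_star_cvg fs f & weak_star_cvg gs g]].

Definition mixed_coderiv (F : U -> set V) (w : U * V) (g : dual V) :
    set (dual U) :=
  [set f : dual U | exists eps u fs gs,
    [/\ normal_sequence (graph F) w eps u fs gs,
        weak_star_cvg fs f & gs @ \oo --> g]].

Definition psnc (F : U -> set V) (w : U * V) : Prop :=
  forall eps u fs gs, normal_sequence (graph F) w eps u fs gs ->
    weak_star_cvg fs 0 -> gs @ \oo --> (0 : dual V) ->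
    (fun k => `|fs k|) @ \oo --> (0 : R).

(* The pair in the normal cone is (fs k, - gs k), so it is - gs k that lies in
   the duality image. *)
Definition mirror_coderiv (F : U -> set V) (Theta : set V) (w : U * V)
    (g : dual V) : set (dual U) :=
  [set f : dual U | exists eps u fs gs,
    [/\ normal_sequence (graph (restrict_range F Theta)) w eps u fs gs,
        forall k, duality_image (tangent_cone Theta (u k).2) (- gs k),
        weak_star_cvg fs f & gs @ \oo --> g]].

Definition mirror_psnc (F : U -> set V) (Theta : set V) (w : U * V) : Prop :=
  forall eps u fs gs,
    normal_sequence (graph (restrict_range F Theta)) w eps u fs gs ->
    (forall k, duality_image (tangent_cone Theta (u k).2) (- gs k)) ->
    weak_star_cvg fs 0 -> gs @ \oo --> (0 : dual V) ->
    (fun k => `|fs k|) @ \oo --> (0 : R).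

End Coderivatives.

Definition inner_semicontinuous (R : realType) (P Y : normedModType R)
    (G : P -> set Y) (D : set P) (p : P) (y : Y) : Prop :=
  forall u : nat -> P, (forall k, (mdom G `&` D) (u k)) -> u @ \oo --> p ->
    exists2 v : nat -> Y, forall k, G (u k) (v k) & v @ \oo --> y.

Section StrictDerivative.
Variables (R : realType) (Y Z : normedModType R).

(* On the diagonal the numerator vanishes and the quotient is 0. *)
Definition strictly_differentiable (f : Y -> Z) (y : Y) : Prop :=
  differentiable f y /\
  (fun p : Y * Y =>
     `|f p.1 - f p.2 - 'd f y (p.1 - p.2)| / `|p.1 - p.2|)
    @ (y, y) --> (0 : R).

Lemma adjoint_subproof (f : Y -> Z) (y : Y) :
  strictly_differentiable f y ->
  forall g : dual Z, (g \o 'd f y : Y -> R^o) \in @dual_pred R Y.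
Proof.
move=> [df _] g; apply/asboolP; split=> [a u v|x]; first by rewrite /= !linearP.
apply: continuous_comp; last exact: dual_continuous.
exact: diff_continuous.
Qed.

Definition derivative_adjoint (f : Y -> Z) (y : Y)
    (fy : strictly_differentiable f y) (g : dual Z) : dual Y :=
  Dual (adjoint_subproof fy g).

End StrictDerivative.

(* Main.v *)
Require Import Defs.
From HB Require Import structures.
From mathcomp Require Import all_boot all_order all_algebra.
From mathcomp Require Import ring lra.
From mathcomp Require Import all_classical all_reals all_analysis.

Set Implicit Arguments.
Unset Strict Implicit.
Unset Printing Implicit Defensive.

Import Order.TTheory GRing.Theory Num.Theory.
Import numFieldNormedType.Exports.

Local Open Scope classical_set_scope.
Local Open Scope ring_scope.

(* Take functionals (f_k, - g_k) that are almost normal to the graph of S2 o S1 at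
   (x_k, z_k). Inner semicontinuity supplies y_k in S1 x_k with z_k in S2 y_k and
   y_k -> ybar, so they are almost normal to the composition of the two graphs.
   Ekeland's principle applied to
     sqrt (|y - y'|^2 + max(phi(x, z), 0)^2),
   where (x, y) and (y', z) range over the two graphs and phi is - f_k + g_k
   corrected by the normality error, yields nearby points, a multiplier mu_k >= 0
   and a functional h_k on Y with mu_k^2 + |h_k|^2 = 1 such that
   (mu_k f_k, - h_k) and (h_k, - mu_k g_k) are almost normal to the two graphs.
   Since Omega is convex, its tangent cone is inner semicontinuous, and the duality
   map is norm continuous because the norm is Frechet smooth; hence f_k can be
   corrected to lie in the duality image of the tangent cone at the new point.
   If mu_k -> 0, a weak* limit of the h_k lies in the intersection assumed trivial,
   and PSNC contradicts |h_k| -> 1; otherwise divide by mu_k and extract a weak*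
   convergent subsequence. For a strictly differentiable S2 the linearization of f
   can be inserted directly. *)

(** * Ekeland's principle *)

Lemma cvgn_distP (R : realType) (V : normedModType R) (u : nat -> V) (l : V) :
  u @ \oo --> l <->
  forall e, 0 < e -> exists N, forall n, (N <= n)%N -> `|u n - l| <= e.
Proof.
rewrite cvgrPdist_le; split=> ul e e0.
  by have [N _ uN] := ul e e0; exists N => n Nn; rewrite distrC; exact: uN.
by have [N uN] := ul e e0; exists N => // n /uN; rewrite distrC.
Qed.

(* Completeness as a property: the product of two completeNormedModType has no
   such canonical structure. *)
Definition seq_complete (R : realType) (V : normedModType R) : Prop :=
  forall u : nat -> V,
    (forall e, 0 < e ->
       exists N, forall n m, (N <= n)%N -> (N <= m)%N -> `|u n - u m| <= e) ->
    exists l : V, u @ \oo --> l.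

Lemma seq_complete_of_complete (R : realType) (V : completeNormedModType R) :
  seq_complete V.
Proof.
move=> u uc; suff: cvgn u by move=> ?; exists (limn u).
apply/cauchy_cvgP/cauchy_ballP => e e0.
have [N uN] := uc (e / 2) (divr_gt0 e0 (ltr0Sn _ 1)).
exists (u @` [set n | N <= n]%N, u @` [set n | N <= n]%N).
  by split; exists N => // n Nn; exists n.
move=> [_ _] [/= [n Nn <-] [m Nm <-]]; rewrite -ball_normE /ball_/=.
by rewrite (le_lt_trans (uN _ _ Nn Nm))// gtr_pMr// invf_lt1// ltr1n.
Qed.

Lemma seq_complete_prod (R : realType) (V W : normedModType R) :
  seq_complete V -> seq_complete W -> seq_complete (V * W)%type.
Proof.
move=> cV cW u uc.
have [|l ul] := cV (fst \o u).
  move=> e /uc[N uN]; exists N => n m Nn Nm /=.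
  by rewrite (le_trans _ (uN _ _ Nn Nm))// prod_normE/= le_max lexx.
have [|r ur] := cW (snd \o u).
  move=> e /uc[N uN]; exists N => n m Nn Nm /=.
  by rewrite (le_trans _ (uN _ _ Nn Nm))// prod_normE/= le_max lexx orbT.
exists (l, r); apply/cvgn_distP => e e0.
have [N1 uN1] := (cvgn_distP _ _).1 ul _ e0.
have [N2 uN2] := (cvgn_distP _ _).1 ur _ e0.
exists (maxn N1 N2) => n; rewrite geq_max => /andP[n1 n2].
by rewrite prod_normE/= ge_max uN1//= uN2.
Qed.

(** Descend along [S], each time nearly minimizing [phi] on [S (u n)]. The decrease of [phi]
    controls the steps, so the sequence is Cauchy; its limit lies in every [S (u n)], and a point
    violating the last claim there would contradict the near-minimization. *)
Lemma ekeland (R : realType) (V : normedModType R) (C : set V) (phi : V -> R)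
    (p : V) (s : R) :
  seq_complete V -> closed C -> continuous (phi : V -> R^o) ->
  (forall q, C q -> 0 <= phi q) -> C p -> 0 < s ->
  exists q, [/\ C q, phi q + s * `|q - p| <= phi p &
    forall r, C r -> phi q <= phi r + s * `|r - q|].
Proof.
move=> cV cC cphi phi0 Cp s0.
pose S p q := C q /\ phi q + s * `|q - p| <= phi p.
have S_refl q : C q -> S q q by move=> Cq; split=> //; rewrite subrr normr0 mulr0 addr0.
have S_trans a b c : S a b -> S b c -> S a c.
  move=> [_ ab] [Cc bc]; split=> //; apply: le_trans ab.
  rewrite -(lerD2r (s * `|b - a|)) in bc; apply: le_trans bc.
  rewrite -addrA lerD2l -mulrDr ler_pM2l// (le_trans _ (ler_normD _ _))//.
  by rewrite addrA subrK.
(* The premise [C nq.2] stays inside the existential so that [choice] yields a total function. *)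
have step (nq : nat * V) : exists r, C nq.2 -> S nq.2 r /\
    forall t, S nq.2 t -> phi r <= phi t + nq.1.+1%:R^-1.
  have [Cq|] := pselect (C nq.2); last by exists nq.2.
  have hi : has_inf (phi @` S nq.2).
    split; first by exists (phi nq.2), nq.2 => //; exact: S_refl.
    by exists 0 => _ [r [Cr _] <-]; exact: phi0.
  have n0 : (0 : R) < nq.1.+1%:R^-1 by rewrite invr_gt0 ltr0n.
  have [_ [r Sr <-] rlt] := inf_adherent n0 hi.
  exists r => _; split=> // t St; rewrite (le_trans (ltW rlt))// lerD2r.
  by apply: ge_inf; [exact: hi.2|exists t].
have [F FS] := choice step.
pose u := fix u n := if n is n'.+1 then F (n', u n') else p.
have Cu n : C (u n).
  by elim: n => [//|n Cn]; have [[]] := FS (n, u n) Cn.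
have Su n m : (n <= m)%N -> S (u n) (u m).
  elim: m => [|m IH]; first by rewrite leqn0 => /eqP->; exact: S_refl.
  rewrite leq_eqVlt => /predU1P[->|]; first exact: S_refl.
  rewrite ltnS => /IH h; apply: S_trans h _.
  exact: (FS (m, u m) (Cu m)).1.
have phi_u : cvgn (phi \o u).
  apply: nonincreasing_is_cvgn.
    move=> n m nm; have [_] := Su _ _ nm; apply: le_trans.
    by rewrite lerDl mulr_ge0// ltW.
  by exists 0 => _ [n _ <-]; exact: phi0.
have [l ul] : exists l : V, u @ \oo --> l.
  apply: cV => e e0.
  have [N uN] := (cvgn_distP (phi \o u : nat -> R^o) _).1 phi_u _
    (divr_gt0 (mulr_gt0 s0 e0) (ltr0Sn _ 1)).
  exists N.
  have H n m : (N <= n)%N -> (n <= m)%N -> `|u n - u m| <= e.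
    move=> Nn nm; have [_] := Su _ _ nm.
    have := uN _ (leq_trans Nn nm); have := uN _ Nn.
    rewrite !ler_norml => /andP[_ h1] /andP[h2 _] h3.
    rewrite distrC -(ler_pM2l s0); rewrite /= in h1 h2; lra.
  move=> n m Nn Nm; have [nm|/ltnW mn] := leqP n m; first exact: H.
  by rewrite distrC; exact: H.
have Sl n : S (u n) l.
  split; first by apply: (closed_cvg _ cC _ _ ul); near=> m; exact: Cu.
  have cl : (fun m => phi (u m) + s * `|u m - u n|) @ \oo -->
      phi l + s * `|l - u n|.
    apply: cvgD; first by apply: (cvg_comp _ _ ul); exact: cphi.
    apply: cvgMl_tmp.
    by apply: cvg_norm; apply: cvgB => //; apply: cvg_cst.
  have := closed_cvg (fun x => x <= phi (u n)) (@closed_le _ _) _ _ cl.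
  by apply; exists n => // m nm; exact: (Su n m nm).2.
exists l; split; [exact: (Sl 0%N).1|exact: (Sl 0%N).2|move=> r Cr].
rewrite leNgt; apply/negP => rl.
(* A violating [r] lies in every [S (u n)], so [phi (u n.+1)] is at most [phi r] plus 1/(n+1). In
   the limit [phi l <= phi r], against [rl]. *)
have Sr n : S (u n) r by apply: S_trans (Sl n) _; split=> //; exact: ltW.
have : phi l <= phi r.
  have lim : (phi \o u) @ \oo --> phi l.
    by apply: (cvg_comp _ _ ul); exact: cphi.
  apply/ler_addgt0Pr => e e0.
  have [N1 uN1] := (cvgn_distP (phi \o u : nat -> R^o) _).1 lim _
    (divr_gt0 e0 (ltr0Sn _ 1)).
  have [N2 _ hN2] := near_infty_natSinv_lt (PosNum (divr_gt0 e0 (ltr0Sn _ 1))).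
  pose n := maxn N1 N2.
  have := uN1 n.+1 (leq_trans (leq_maxl _ _) (leqnSn _)).
  have := hN2 n (leq_maxr _ _).
  have := (FS (n, u n) (Cu n)).2 _ (Sr n).
  rewrite ler_norml /=; move: (_^-1) => i h1 h2 /andP[h3 h4]; lra.
have : 0 <= s * `|r - l| by rewrite mulr_ge0// ltW.
lra.
Unshelve. all: by end_near. Qed.

(** * Frechet smooth norms and the duality map *)

Lemma dual_abs_le (R : realType) (X : normedModType R) (f : dual X) x :
  `|f x| <= `|f| * `|x|.
Proof. exact: dual_normP. Qed.

Lemma dual_ler (R : realType) (X : normedModType R) (f : dual X) x :
  f x <= `|f| * `|x|.
Proof. by rewrite (le_trans (ler_norm _))// dual_abs_le. Qed.

(** Testing at [d *: x] and at its opposite recovers the norm from one-sided estimates on a small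
    ball, the form in which first-order expansions deliver them. *)
Lemma dual_norm_leP (R : realType) (X : normedModType R) (f : dual X) (r d : R) :
  0 < d -> (forall h, `|h| <= d -> f h <= r * d) -> `|f| <= r.
Proof.
move=> d0 fr; apply: dual_norm_le => x x1.
have dx : `|d *: x| <= d by rewrite normrZ gtr0_norm// ger_pMr.
have dNx : `|d *: - x| <= d by rewrite scalerN normrN.
have := fr _ dx; have := fr _ dNx.
rewrite !linearZ linearN /= /GRing.scale /= => h1 h2.
rewrite ler_norml -(ler_pM2l d0) -[X in _ && X](ler_pM2l d0).
by apply/andP; split; lra.
Qed.

Lemma frechet_expansion (R : realType) (X : normedModType R) (v : X) :
  differentiable (fun y : X => `|y| : R^o) v ->
  exists D : dual X, forall e, 0 < e -> exists2 d, 0 < d &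
    forall h, `|h| <= d -> `|(`|v + h|) - (`|v|) - D h| <= e * `|h|.
Proof.
move=> dv; pose D0 := 'd (fun y : X => `|y| : R^o) v.
have DP : (D0 : X -> R^o) \in @dual_pred R X.
  apply/asboolP; split; [exact: linearP|exact: diff_continuous].
exists (Dual DP) => e e0.
have /eqaddoP/(_ e e0) := diff_locally dv.
move=> /nbhs_normP[d /= d0 hd].
exists (d / 2); rewrite ?divr_gt0// => h hh.
have := hd h; rewrite /= sub0r normrN (le_lt_trans hh) ?gtr_pMr ?invf_lt1 ?ltr1n//.
move=> /(_ isT); rewrite /= !fctE /= [h + v]addrC.
by rewrite opprD addrA.
Qed.

(** For [v] nonzero, the derivative [D] of the norm at [v] satisfies D h <= |h| by the triangle
    inequality and D v = |v| by homogeneity, so |v| D belongs to the duality map. At 0 the square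
    itself is negligible and [j] is 0. *)
Lemma sqr_norm_expansion (R : realType) (X : normedModType R) (v : X) :
  frechet_smooth_norm X ->
  exists2 j, duality_map v j & forall e, 0 < e -> exists2 d, 0 < d &
    forall h, `|h| <= d -> `|v + h| ^+ 2 <= `|v| ^+ 2 + 2 * j h + e * `|h|.
Proof.
move=> sX; have [->|v0] := eqVneq v 0.
  exists 0 => [|e e0]; first by split; rewrite /= ?normr0 ?expr0n.
  exists e => // h he; rewrite add0r normr0 expr0n /= mulr0 !add0r expr2.
  by rewrite ler_wpM2r.
have [D DP] := frechet_expansion (sX v v0).
have nv : 0 < `|v| by rewrite normr_gt0.
have D_le h : D h <= `|h|.
  have [->|h0] := eqVneq h 0; first by rewrite linear0 normr0.
  have nh : 0 < `|h| by rewrite normr_gt0.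
  apply/ler_addgt0Pr => e e0.
  have [d d0 /(_ ((d / `|h|) *: h))] := DP _ (divr_gt0 e0 nh).
  have dh : `|d / `|h| *: h| = d.
    by rewrite normrZ normrM normfV normr_id gtr0_norm// divfK// gt_eqF.
  rewrite dh lexx => /(_ isT).
  have := ler_normD v (d / `|h| *: h); rewrite dh.
  rewrite linearZ /= /GRing.scale /= => h1 /ler_normlP[h2 _].
  have {h1 h2} : d / `|h| * D h <= d + e / `|h| * d by lra.
  have -> : d + e / `|h| * d = d / `|h| * (`|h| + e) by field; rewrite gt_eqF.
  by rewrite ler_pM2l// divr_gt0.
have D_v : D v = `|v|.
  apply/eqP; rewrite eq_le D_le /=; apply/ler_addgt0Pr => e e0.
  have [d d0 /(_ ((d / `|v|) *: v))] := DP _ (divr_gt0 e0 nv).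
  have dv0 : 0 < d / `|v| by rewrite divr_gt0.
  have dh : `|d / `|v| *: v| = d.
    by rewrite normrZ gtr0_norm// divfK// gt_eqF.
  rewrite dh lexx => /(_ isT).
  have -> : `|v + d / `|v| *: v| = `|v| + d.
    rewrite -[X in X + _]scale1r -scalerDl normrZ gtr0_norm ?addr_gt0//.
    by rewrite mulrDl mul1r divfK// gt_eqF.
  rewrite linearZ /= /GRing.scale /= => /ler_normlP[_ h2].
  have {h2} : d / `|v| * `|v| <= d / `|v| * (D v + e).
    have -> : d / `|v| * `|v| = d by rewrite divfK// gt_eqF.
    have -> : d / `|v| * (D v + e) = d / `|v| * D v + e / `|v| * d by ring.
    lra.
  by rewrite ler_pM2l// divr_gt0.
exists (`|v| *: D).
  split; first by rewrite dualZ D_v expr2.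
  rewrite normrZ normr_id; have -> : `|D| = 1; last by rewrite mulr1.
  apply/eqP; rewrite eq_le; apply/andP; split.
    by apply: (@dual_norm_leP _ _ _ _ 1) => // h h1; rewrite mulr1 (le_trans (D_le _)).
  by have := dual_ler D v; rewrite D_v ler_pMl.
(* With r = |v + h| - |v|, the term 2 |v| r costs an error e/2 |h|, and r^2 <= |h|^2 the other
   half. *)
move=> e e0; have v10 : 0 < 4 * (`|v| + 1) by rewrite mulr_gt0// addr_gt0.
have [d d0 dP] := DP _ (divr_gt0 e0 v10).
exists (Num.min d (e / 2)); first by rewrite lt_min d0 divr_gt0.
move=> h; rewrite le_min => /andP[hd he].
have /ler_normlP[_ h1] := dP _ hd; rewrite dualZ.
pose r := `|v + h| - `|v|.
have r2 : r ^+ 2 <= `|h| ^+ 2.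
  rewrite -(real_normK (num_real r)) ler_sqr ?nnegrE//.
  by rewrite (le_trans (ler_dist_dist _ _))// addrC addKr.
have -> : `|v + h| ^+ 2 = `|v| ^+ 2 + 2 * `|v| * r + r ^+ 2 by rewrite /r; ring.
have h2 : `|v| * r <= `|v| * D h + e / 4 * `|h|.
  apply: (@le_trans _ _ (`|v| * (D h + e / (4 * (`|v| + 1)) * `|h|))).
    by rewrite ler_pM2l// /r; lra.
  rewrite mulrDr lerD2l mulrA ler_wpM2r//.
  rewrite mulrCA ler_pM2l// invfM mulrCA ger_pMr ?invr_gt0//.
  by rewrite ler_pdivrMr ?addr_gt0// mul1r lerDl.
have h3 : `|h| ^+ 2 <= e / 2 * `|h| by rewrite expr2 ler_wpM2r.
have := r2; lra.
Qed.

(** Up to the factor 2, [f] is a subgradient of the squared norm at [v]: combine f x <= |v| |x| with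
    (|x| - |v|)^2 >= 0. *)
Lemma duality_map_subgradient (R : realType) (X : normedModType R) (v x : X)
    (f : dual X) :
  duality_map v f -> `|v| ^+ 2 + 2 * f (x - v) <= `|x| ^+ 2.
Proof.
move=> [fv nf]; rewrite linearB /= fv.
have := dual_ler f x; rewrite nf.
have := sqr_ge0 (`|x| - `|v|); rewrite sqrrB; lra.
Qed.

(** The subgradient inequality at [v'], tested at [v + h], is played against the first-order upper
    bound at [v]. The difference of the functionals is then small on a ball of fixed radius, hence
    in norm. *)
Lemma duality_map_continuous (R : realType) (X : normedModType R) (v : X)
    (f : dual X) :
  frechet_smooth_norm X -> duality_map v f ->
  forall e, 0 < e -> exists2 d, 0 < d &
    forall v' f', `|v' - v| <= d -> duality_map v' f' -> `|f' - f| <= e.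
Proof.
move=> sX Jf; have [j Jj jP] := sqr_norm_expansion v sX.
have cont e : 0 < e -> exists2 d, 0 < d &
    forall v' f', `|v' - v| <= d -> duality_map v' f' -> `|f' - j| <= e.
  move=> e0; have [d d0 dP] := jP _ e0.
  have v30 : 0 < 4 * `|v| + 3 by rewrite ltr_wpDl// mulr_ge0.
  (* The factor 4|v| + 3 adds up 2|v| + 1, from |v|^2 - |v'|^2, and 2(|v| + 1), from 2 |v'| |v' -
     v|; both estimates use |v' - v| <= 1. *)
  exists (Num.min 1 (e * d / (4 * `|v| + 3))).
    by rewrite lt_min ltr01 divr_gt0// mulr_gt0.
  move=> v' f'; rewrite le_min => /andP[v'1 v'd] Jf'.
  apply: (dual_norm_leP d0) => h hd.
  have -> : (f' - j) h = f' h - j h by [].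
  have h1 := dP _ hd.
  have h2 := duality_map_subgradient (v + h) Jf'.
  rewrite -addrA [h - v']addrC addrA linearD /= in h2.
  have h3 : - f' (v - v') <= `|v'| * `|v' - v|.
    by rewrite -linearN opprB -(Jf'.2) dual_ler.
  have h4 : `|v| <= `|v'| + `|v' - v|.
    by have := ler_normB v' (v' - v); rewrite opprB addrC subrK.
  have h5 : `|v'| <= `|v| + `|v' - v|.
    by have := ler_normD v (v' - v); rewrite addrC subrK.
  have h6 : e * `|h| <= e * d by rewrite ler_pM2l.
  have h7 : (4 * `|v| + 3) * `|v' - v| <= e * d by rewrite mulrC -ler_pdivlMr.
  move: h3 h4 h5 h7 v'1 (normr_ge0 v) (normr_ge0 v') (normr_ge0 (v' - v)).
  move: `|v' - v| => r h3 h4 h5 h7 r1 a0 b0 r0.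
  have h8 : `|v| ^+ 2 <= `|v'| ^+ 2 + r * (2 * `|v| + 1).
    have : `|v| ^+ 2 <= (`|v'| + r) ^+ 2 by rewrite ler_sqr ?nnegrE// addr_ge0.
    have : r * `|v'| <= r * (`|v| + r) by rewrite ler_wpM2l.
    have : r * r <= r * 1 by rewrite ler_wpM2l.
    rewrite sqrrD; nra.
  have h9 : `|v'| * r <= (`|v| + 1) * r by rewrite ler_wpM2r//; lra.
  lra.
(* Applied at [v' = v], the estimate shows that the duality map is single-valued. *)
have jf : f = j.
  apply/eqP; rewrite -subr_eq0 -normr_le0; apply/ler_addgt0Pr => e e0.
  have [d d0 /(_ v f)] := cont _ e0.
  by rewrite subrr normr0 add0r; apply => //; exact: ltW.
by rewrite jf.
Qed.

Lemma duality_mapZ (R : realType) (X : normedModType R) (v : X) (f : dual X)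
    (a : R) : 0 <= a -> duality_map v f -> duality_map (a *: v) (a *: f).
Proof.
move=> a0 [fv nf]; split.
  by rewrite dualZ linearZ /= /GRing.scale /= fv normrZ (ger0_norm a0) exprMn expr2 mulrA.
by rewrite !normrZ nf.
Qed.

(** * Tangent cones and their duality images *)

Lemma tangent_coneZ (R : realType) (X : normedModType R) (Omega : set X)
    (x w : X) (a : R) :
  0 <= a -> Omega x -> tangent_cone Omega x w -> tangent_cone Omega x (a *: w).
Proof.
rewrite le_eqVlt => /predU1P[<- Ox _|a0 _ [t [v [t0 tc vc tv]]]].
  exists harmonic, (fun=> 0); split=> [k| | |k].
  - by rewrite invr_gt0 ltr0n.
  - exact: cvg_harmonic.
  - by rewrite scale0r; apply: cvg_cst.
  - by rewrite scaler0 addr0.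
exists (fun k => a^-1 * t k), (fun k => a *: v k); split=> [k| | |k].
- by rewrite mulr_gt0 ?invr_gt0.
- by rewrite -(mulr0 a^-1); apply: cvgMl_tmp.
- exact: cvgZl_tmp.
- by rewrite scalerA mulrAC mulVf ?gt_eqF// mul1r.
Qed.

Lemma duality_tangentZ (R : realType) (X : normedModType R) (Omega : set X)
    (x : X) (f : dual X) (a : R) : 0 <= a -> Omega x ->
  duality_image (tangent_cone Omega x) f ->
  duality_image (tangent_cone Omega x) (a *: f).
Proof.
move=> a0 Ox [w Tw Jw]; exists (a *: w); first exact: tangent_coneZ.
exact: duality_mapZ.
Qed.

Lemma convex_set_segment (R : realType) (X : normedModType R) (Omega : set X)
    (x y : X) (s : R) : convex_set Omega -> Omega x -> Omega y ->
  0 <= s -> s <= 1 -> Omega (x + s *: (y - x)).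
Proof.
move=> cO Ox Oy s0 s1.
have := cO y x (Itv01 s0 s1) (mem_set Oy) (mem_set Ox) => /set_mem.
suff <- : s *: y + (1 - s) *: x = x + s *: (y - x) by [].
by rewrite scalerBr scalerBl scale1r addrCA.
Qed.

(** The vector [w] is nearly (u - x0)/t for one fixed point [u] of [Omega] and one fixed t > 0. By
    convexity (u - x)/t is tangent at [x], and it differs from (u - x0)/t by |x - x0|/t only. *)
Lemma tangent_cone_lsc (R : realType) (X : normedModType R) (Omega : set X)
    (x0 w : X) : convex_set Omega -> tangent_cone Omega x0 w ->
  forall e, 0 < e -> exists2 d, 0 < d &
    forall x, Omega x -> `|x - x0| <= d ->
      exists2 w', tangent_cone Omega x w' & `|w' - w| <= e.
Proof.
move=> cO [t [v [t0 tc vc tv]]] e e0.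
have e20 : 0 < e / 2 by rewrite divr_gt0.
have [N /(_ N (leqnn _)) vN] := (cvgn_distP _ _).1 vc _ e20.
exists (t N * (e / 2)); first by rewrite mulr_gt0.
move=> x Ox xx0; pose u := x0 + t N *: v N; pose w' := (t N)^-1 *: (u - x).
have tN0 : t N != 0 by rewrite gt_eqF.
exists w'.
  exists (fun k => t N * k.+1%:R^-1), (fun=> w'); split=> [k| | |k].
  - by rewrite mulr_gt0// invr_gt0 ltr0n.
  - by rewrite -(mulr0 (t N)); apply: cvgMl_tmp; exact: cvg_harmonic.
  - exact: cvg_cst.
  - rewrite scalerA mulrAC divff// mul1r.
    apply: convex_set_segment => //; first exact: tv.
    by rewrite invf_le1 ?ltr0n// ler1n.
have -> : w' - w = (t N)^-1 *: (x0 - x) + (v N - w).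
  rewrite /w' /u [x0 + _ - x]addrAC scalerDr scalerA mulVf// scale1r.
  by rewrite addrA.
rewrite (le_trans (ler_normD _ _))// [leRHS]splitr lerD//.
rewrite normrZ gtr0_norm ?invr_gt0// distrC.
by rewrite ler_pdivrMl.
Qed.

(** This allows a functional to be moved back into the duality image after its base point has been
    perturbed. *)
Lemma duality_tangent_lsc (R : realType) (X : normedModType R) (Omega : set X)
    (x0 : X) (f : dual X) : frechet_smooth_norm X -> convex_set Omega ->
  duality_image (tangent_cone Omega x0) f ->
  forall e, 0 < e -> exists2 d, 0 < d &
    forall x, Omega x -> `|x - x0| <= d ->
      exists2 f', duality_image (tangent_cone Omega x) f' & `|f' - f| <= e.
Proof.
move=> sX cO [w Tw Jw] e e0.
have [d1 d10 d1P] := duality_map_continuous sX Jw e0.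
have [d d0 dP] := tangent_cone_lsc cO Tw d10.
exists d => // x Ox xx0; have [w' Tw' w'w] := dP x Ox xx0.
have [f' Jf' _] := sqr_norm_expansion w' sX.
by exists f'; [exists w'|exact: d1P Jf'].
Qed.

(** * The fuzzy intersection rule *)

(* Unlike in eps_normal, the error b is not scaled by the norm of (f, g). *)
Definition abs_normal (R : realType) (U V : normedModType R) (b : R)
    (L : set (U * V)) (w : U * V) (f : dual U) (g : dual V) : Prop :=
  forall e, 0 < e -> exists2 d, 0 < d &
    forall u, L u -> `|u - w| <= d ->
      f (u.1 - w.1) + g (u.2 - w.2) <= (b + e) * `|u - w|.

Definition relcomp (X Y Z : Type) (A : set (X * Y)) (B : set (Y * Z)) :
    set (X * Z) :=
  [set p | exists y, A (p.1, y) /\ B (y, p.2)].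

Lemma norm_fst_le (R : realType) (U V : normedModType R) (u : U * V) :
  `|u.1| <= `|u|.
Proof. by rewrite [leRHS]prod_normE le_max lexx. Qed.

Lemma norm_snd_le (R : realType) (U V : normedModType R) (u : U * V) :
  `|u.2| <= `|u|.
Proof. by rewrite [leRHS]prod_normE le_max lexx orbT. Qed.

Lemma norm_pair_le (R : realType) (U V : normedModType R) (u : U * V) r :
  `|u.1| <= r -> `|u.2| <= r -> `|u| <= r.
Proof. by move=> u1 u2; rewrite prod_normE ge_max u1. Qed.

(** The function max(t, 0)^2 is nondecreasing, and its derivative 2 max(t, 0) is 2-Lipschitz, so
    [d ^+ 2] bounds the remainder. *)
Lemma sqr_max0_le (R : realType) (a b d : R) : b <= a + d ->
  (Num.max b 0) ^+ 2 <= (Num.max a 0) ^+ 2 + 2 * Num.max a 0 * d + d ^+ 2.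
Proof.
move=> bad; case: (leP b 0) => b0; case: (leP a 0) => a0.
- by rewrite expr0n /= mulr0 mul0r !add0r sqr_ge0.
- have := sqr_ge0 (a + d); rewrite sqrrD expr0n /=; lra.
- have : b ^+ 2 <= d ^+ 2 by rewrite ler_sqr ?nnegrE//; lra.
  by rewrite expr0n /= mulr0 mul0r !add0r.
- have : b ^+ 2 <= (a + d) ^+ 2 by rewrite ler_sqr ?nnegrE//; lra.
  by rewrite sqrrD -mulr_natl mulrA.
Qed.

Lemma continuous_dual (R : realType) (T : topologicalType) (U : normedModType R)
    (f : dual U) (h : T -> U) : continuous h -> continuous (fun t => f (h t) : R^o).
Proof. by move=> ch t; apply: continuous_comp; [exact: ch|exact: dual_continuous]. Qed.

Section fuzzy.
Variables (R : realType) (X Y Z : normedModType R).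
Variables (A : set (X * Y)) (B : set (Y * Z)) (x0 : X) (y0 : Y) (z0 : Z).
Variables (f : dual X) (g : dual Z) (b r s : R).
Hypotheses (smY : frechet_smooth_norm Y).
Hypotheses (cX : seq_complete X) (cY : seq_complete Y) (cZ : seq_complete Z).
Hypotheses (Axy : A (x0, y0)) (Byz : B (y0, z0)).
Hypotheses (cA : closed A) (cB : closed B).
Hypotheses (b0 : 0 <= b) (r0 : 0 < r) (s0 : 0 < s).
Hypothesis fgP : forall u, relcomp A B u -> `|u - (x0, z0)| <= r ->
  f (u.1 - x0) - g (u.2 - z0) <= b * `|u - (x0, z0)|.

Let E : normedModType R := ((X * Y) * (Y * Z))%type.
Let p0 : E := ((x0, y0), (y0, z0)).
(** This is the value of [psi] at [p0], chosen so that Ekeland's principle with slope [s] displaces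
    the point by at most r/2. *)
Let ac : R := s * (r / 2).
(** By [fgP], [phi] is at least [ac] at points of the ball whose two middle components agree. *)
Let phi (p : E) : R :=
  - f (p.1.1 - x0) + g (p.2.2 - z0) + b * `|(p.1.1, p.2.2) - (x0, z0)| + ac.
(** The Euclidean combination yields gradient weights whose squares sum to 1, the normalization of
    the multipliers. *)
Let psi (p : E) : R :=
  Num.sqrt (`|p.1.2 - p.2.1| ^+ 2 + (Num.max (phi p) 0) ^+ 2).

Let ac0 : 0 < ac. Proof. by rewrite mulr_gt0// divr_gt0. Qed.

Let psi_cont : continuous (psi : E -> R^o).
Proof.
have c11 : continuous (fun p : E => p.1.1).
  by move=> p; apply: continuous_comp; exact: cvg_fst.
have c12 : continuous (fun p : E => p.1.2).
  by move=> p; apply: continuous_comp; [exact: cvg_fst|exact: cvg_snd].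
have c21 : continuous (fun p : E => p.2.1).
  by move=> p; apply: continuous_comp; [exact: cvg_snd|exact: cvg_fst].
have c22 : continuous (fun p : E => p.2.2).
  by move=> p; apply: continuous_comp; exact: cvg_snd.
have cB1 (W : normedModType R) (h : E -> W) (w : W) : continuous h ->
    continuous (fun p => h p - w).
  by move=> ch p; apply: cvgB; [exact: ch|exact: cvg_cst].
have cphi : continuous (phi : E -> R^o).
  move=> p; apply: cvgD; last exact: cvg_cst.
  apply: cvgD; last first.
    apply: cvgMl_tmp; apply: cvg_norm; apply: cvgB; last exact: cvg_cst.
    by apply: cvg_pair; [exact: c11|exact: c22].
  apply: cvgD.
    apply: cvgN; apply: (@continuous_dual _ _ _ f (fun q : E => q.1.1 - x0)).
    exact: cB1.
  by apply: (@continuous_dual _ _ _ g (fun q : E => q.2.2 - z0)); exact: cB1.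
move=> p; apply: continuous_comp; last exact: sqrt_continuous.
apply: cvgD.
  by apply: cvgM; apply: cvg_norm; apply: cvgB;
    [exact: c12|exact: c21|exact: c12|exact: c21].
have cm : (fun p => Num.max (phi p) 0) @ p --> Num.max (phi p) 0.
  have -> : (fun p => Num.max (phi p) 0) = (fun p => (phi p + `|phi p|) / 2).
    by apply/funext => q; rewrite maxr_absE addr0 subr0.
  rewrite maxr_absE addr0 subr0; apply: cvgMr_tmp.
  by apply: cvgD; [exact: cphi|apply: cvg_norm; exact: cphi].
exact: cvgM.
Qed.

(** Either the middle components differ, or (x, z) lies in the composition and [phi] is positive.
    Positivity makes the expansion of the square root possible. *)
Let psi_gt0 p : A p.1 -> B p.2 -> `|p - p0| <= r -> 0 < psi p.
Proof.
move: p => [[x y] [y' z]] /= Ap Bp pr.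
rewrite sqrtr_gt0 /=; have [yy'|yy'] := eqVneq y' y; last first.
  by rewrite ltr_pwDl ?sqr_ge0// exprn_gt0// normr_gt0 subr_eq0 eq_sym.
subst y'.
rewrite subrr normr0 expr0n/= add0r exprn_gt0// lt_max.
have -> // : 0 < phi (x, y, (y, z)).
rewrite /phi /=.
suff : f (x - x0) - g (z - z0) <= b * `|(x, z) - (x0, z0)| by have := ac0; lra.
apply: (fgP (u := (x, z))).
  by exists y.
apply: norm_pair_le => /=; apply: le_trans pr.
  exact: le_trans (norm_fst_le (((x, y), (y, z)) - p0).1) (norm_fst_le _).
exact: le_trans (norm_snd_le (((x, y), (y, z)) - p0).2) (norm_snd_le _).
Qed.

Let D : set E := [set p | [/\ A p.1, B p.2 & `|p - p0| <= r]].

Let D_closed : closed D.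
Proof.
have -> : D = (fst @^-1` A) `&` (snd @^-1` B) `&`
    ((fun p : E => `|p - p0| : R^o) @^-1` [set t | t <= r]).
  by apply/seteqP; split=> [p [? ? ?]|p [[? ?] ?]].
apply: closedI; [apply: closedI|]; apply: closed_comp => //.
- by move=> p _; exact: cvg_fst.
- by move=> p _; exact: cvg_snd.
- by move=> p _; apply: cvg_norm; apply: cvgB; [exact: cvg_id|exact: cvg_cst].
Qed.

Let psi_p0 : psi p0 = ac.
Proof.
rewrite /psi /phi /= !subrr normr0 !linear0 normr0 mulr0 expr0n/= ?oppr0 !add0r.
by rewrite max_l ?ltW// sqrtr_sqr gtr0_norm.
Qed.

(** The bound r/2 leaves room around [q]: the ball constraint in [D] is inactive near it. *)
Let psi_ekeland : exists q, [/\ D q, `|q - p0| <= r / 2 &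
  forall p, D p -> psi q <= psi p + s * `|p - q|].
Proof.
have [||||||q [Dq qp qP]] := @ekeland R E D psi p0 s => //.
- by apply: seq_complete_prod; apply: seq_complete_prod.
- by move=> p _; exact: sqrtr_ge0.
- by split; rewrite //= subrr normr0 ltW.
exists q; split=> //; rewrite psi_p0 in qp.
rewrite -(ler_pM2l s0) (le_trans _ qp)// lerDr; exact: sqrtr_ge0.
Qed.

(** The pair (k, mu) is the gradient of the Euclidean norm at (v, m), that is J(v) and m divided by
    [psi q]. Squares are expanded instead of the square root, and the factor [psi q] is cancelled at
    the end. The term [b] of the error comes from the correction inside [phi], weighted by m <= psi
    q. *)
Let psi_first_order q : D q -> (forall p, D p -> psi q <= psi p + s * `|p - q|) ->
  exists (mu : R) (k : dual Y), [/\ 0 <= mu, mu ^+ 2 + `|k| ^+ 2 = 1 &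
    forall e, 0 < e -> exists2 d, 0 < d & forall p, D p -> `|p - q| <= d ->
      mu * (f (p - q).1.1 - g (p - q).2.2) - k ((p - q).1.2 - (p - q).2.1) <=
      (b + s + e) * `|p - q|].
Proof.
move=> Dq qP; have [Aq Bq qr] := Dq; have hq := psi_gt0 Aq Bq qr.
pose v := q.1.2 - q.2.1; pose m := Num.max (phi q) 0.
have m0 : 0 <= m by rewrite le_max lexx orbT.
have hq2 : psi q ^+ 2 = `|v| ^+ 2 + m ^+ 2.
  by rewrite sqr_sqrtr// addr_ge0// sqr_ge0.
have [j [jv nj] jP] := sqr_norm_expansion v smY.
have hqu : psi q != 0 by rewrite gt_eqF.
exists (m / psi q), ((psi q)^-1 *: j); split.
- by rewrite divr_ge0// ltW.
- rewrite normrZ nj gtr0_norm ?invr_gt0// !exprMn !exprVn mulrC -mulrDr.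
  by rewrite [m ^+ 2 + _]addrC -hq2 mulVf// expf_neq0.
move=> e e0.
have [d1 d10 d1P] := jP (e * psi q / 2) (divr_gt0 (mulr_gt0 e0 hq) (ltr0Sn _ 1)).
pose K := `|f| + `|g| + b.
have K0 : 0 <= K by rewrite !addr_ge0.
have K10 : 0 < K ^+ 2 + 1 by rewrite ltr_wpDl// sqr_ge0.
(* The first bound serves |dv| <= 2 |h|; the second makes del^2 <= K^2 |h|^2 at most e psi(q)
   |h|. *)
exists (Num.min (d1 / 2) (e * psi q / (K ^+ 2 + 1))).
  by rewrite lt_min !divr_gt0// mulr_gt0.
move=> p Dp; rewrite le_min => /andP[pd1 pK].
set h := p - q in pd1 pK *.
pose dv := h.1.2 - h.2.1.
pose del := - f h.1.1 + g h.2.2 + b * `|(h.1.1, h.2.2)|.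
have n11 : `|h.1.1| <= `|h| := le_trans (norm_fst_le _) (norm_fst_le _).
have n12 : `|h.1.2| <= `|h| := le_trans (norm_snd_le _) (norm_fst_le _).
have n21 : `|h.2.1| <= `|h| := le_trans (norm_fst_le _) (norm_snd_le _).
have n22 : `|h.2.2| <= `|h| := le_trans (norm_snd_le _) (norm_snd_le _).
have npair : `|(h.1.1, h.2.2)| <= `|h| by exact: norm_pair_le.
have dvh : `|dv| <= 2 * `|h|.
  by rewrite (le_trans (ler_normB _ _))// mulr2n mulrDl mul1r lerD.
have phip : phi p <= phi q + del.
  have -> : p = q + h by rewrite addrC subrK.
  rewrite /phi /del.
  have -> : (q + h).1.1 - x0 = (q.1.1 - x0) + h.1.1 by rewrite addrAC.
  have -> : (q + h).2.2 - z0 = (q.2.2 - z0) + h.2.2 by rewrite addrAC.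
  have -> : ((q + h).1.1, (q + h).2.2) - (x0, z0) =
      ((q.1.1, q.2.2) - (x0, z0)) + (h.1.1, h.2.2).
    by congr pair; rewrite addrAC.
  rewrite [f _]linearD [g _]linearD /=.
  have := ler_wpM2l b0 (ler_normD ((q.1.1, q.2.2) - (x0, z0)) (h.1.1, h.2.2)).
  lra.
have max2 := sqr_max0_le phip; rewrite -/m in max2.
have v2 : `|p.1.2 - p.2.1| ^+ 2 <=
    `|v| ^+ 2 + 2 * j dv + e * psi q / 2 * `|dv|.
  have -> : p.1.2 - p.2.1 = v + dv.
    have -> : p = q + h by rewrite addrC subrK.
    by rewrite /= /v /dv opprD addrACA.
  by apply: d1P; rewrite (le_trans dvh)// mulrC -ler_pdivlMr.
have psip : psi p ^+ 2 = `|p.1.2 - p.2.1| ^+ 2 + (Num.max (phi p) 0) ^+ 2.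
  by rewrite sqr_sqrtr// addr_ge0// sqr_ge0.
have sh : 0 <= s * `|h| by rewrite mulr_ge0// ltW.
(* Squaring the Ekeland inequality requires s |h| <= psi q; in the other case the left side is
   nonpositive. *)
have low : psi q ^+ 2 - 2 * psi q * (s * `|h|) <= psi p ^+ 2.
  have := qP p Dp; rewrite -/h => le1.
  have psi0 : 0 <= psi p by exact: sqrtr_ge0.
  have [le2|le2] := leP (s * `|h|) (psi q).
    have : (psi q - s * `|h|) ^+ 2 <= psi p ^+ 2.
      by rewrite ler_sqr ?nnegrE ?subr_ge0// lerBlDr.
    rewrite sqrrB; have := sqr_ge0 (s * `|h|); lra.
  have : psi q * psi q <= psi q * (s * `|h|) by rewrite ler_pM2l// ltW.
  have := sqr_ge0 (psi p); have : 0 <= psi q * (s * `|h|) by rewrite mulr_ge0// ltW.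
  rewrite [psi q ^+ 2]expr2; lra.
have del2 : del ^+ 2 <= e * psi q * `|h|.
  have : `|del| <= K * `|h|.
    rewrite /del /K !mulrDl (le_trans (ler_normD _ _))// lerD//.
      rewrite (le_trans (ler_normD _ _))// normrN lerD//.
        by rewrite (le_trans (dual_abs_le _ _))// ler_wpM2l.
      by rewrite (le_trans (dual_abs_le _ _))// ler_wpM2l.
    by rewrite ger0_norm ?mulr_ge0// ler_wpM2l.
  move=> delK; have : del ^+ 2 <= (K * `|h|) ^+ 2.
    by rewrite -(real_normK (num_real del)) ler_sqr ?nnegrE// mulr_ge0.
  have : (K ^+ 2 + 1) * `|h| * `|h| <= e * psi q * `|h|.
    by rewrite ler_wpM2r// mulrC -ler_pdivlMr.
  have := sqr_ge0 `|h|; rewrite exprMn expr2; lra.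
have dv3 : e * psi q / 2 * `|dv| <= e * psi q * `|h|.
  rewrite -mulrA ler_pM2l ?mulr_gt0//; lra.
have pairm : m * (b * `|(h.1.1, h.2.2)|) <= psi q * (b * `|h|).
  apply: ler_pM => //; rewrite ?mulr_ge0//; last by rewrite ler_wpM2l.
  rewrite -ler_sqr ?nnegrE// ?hq2 ?lerDr ?sqr_ge0//; exact: ltW.
rewrite dualZ -(ler_pM2l hq).
have -> : psi q * (m / psi q * (f h.1.1 - g h.2.2) - (psi q)^-1 * j dv) =
    m * (f h.1.1 - g h.2.2) - j dv by field.
rewrite /del in max2 del2; lra.
Qed.

(** Freezing one of the two blocks of [q] splits the joint inequality into one normality statement
    per graph; moving the other block by at most r/2 stays in [D]. *)
Lemma fuzzy_core : exists (w1 : X * Y) (w2 : Y * Z) (mu : R) (k : dual Y),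
  [/\ A w1 /\ B w2, `|w1 - (x0, y0)| <= r / 2 /\ `|w2 - (y0, z0)| <= r / 2,
      0 <= mu /\ mu ^+ 2 + `|k| ^+ 2 = 1,
      abs_normal (b + s) A w1 (mu *: f) (- k) &
      abs_normal (b + s) B w2 k (- (mu *: g))].
Proof.
have [q [Dq qr qP]] := psi_ekeland.
have [mu [k [mu0 muk muP]]] := psi_first_order Dq qP.
have [Aq Bq _] := Dq.
have r20 : 0 < r / 2 by rewrite divr_gt0.
exists q.1, q.2, mu, k; split=> //.
- split; apply: le_trans qr.
    exact: (norm_fst_le (q - p0)).
  exact: (norm_snd_le (q - p0)).
- move=> e e0; have [d d0 dP] := muP e e0.
  exists (Num.min d (r / 2)); first by rewrite lt_min d0.
  move=> u Au; rewrite le_min => /andP[ud ur].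
  have eu : ((u, q.2) : E) - q = (u - q.1, 0).
    by rewrite -[0](subrr q.2).
  have nu : `|((u, q.2) : E) - q| = `|u - q.1|.
    by rewrite eu [LHS]prod_normE /= normr0 max_l.
  have := dP (u, q.2); rewrite nu eu /= linear0 !subr0; apply => //.
  split=> //=; rewrite (_ : _ - _ = ((u, q.2) - q) + (q - p0)); last first.
    by rewrite addrA subrK.
  by rewrite (le_trans (ler_normD _ _))// nu [leRHS]splitr lerD.
- move=> e e0; have [d d0 dP] := muP e e0.
  exists (Num.min d (r / 2)); first by rewrite lt_min d0.
  move=> u Bu; rewrite le_min => /andP[ud ur].
  have eu : ((q.1, u) : E) - q = (0, u - q.2).
    by rewrite -[0](subrr q.1).
  have nu : `|((q.1, u) : E) - q| = `|u - q.2|.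
    by rewrite eu [LHS]prod_normE /= normr0 max_r.
  have := dP (q.1, u); rewrite nu eu /= linear0 !sub0r.
  rewrite linearN mulrN opprK [- _ + k _]addrC.
  apply => //.
  split=> //=; rewrite (_ : _ - _ = ((q.1, u) - q) + (q - p0)); last first.
    by rewrite addrA subrK.
  by rewrite (le_trans (ler_normD _ _))// nu [leRHS]splitr lerD.
Qed.
End fuzzy.

(** * The Hahn-Banach theorem *)

Section HahnBanach.
Variables (R : realType) (V : lmodType R).
Implicit Types (p q : V -> R).

Definition sublinear p : Prop :=
  (forall x y, p (x + y) <= p x + p y) /\
  (forall t x, 0 <= t -> p (t *: x) <= t * p x).

Lemma sublinear0 p : sublinear p -> p 0 = 0.
Proof.
move=> [pD pZ]; apply/eqP; rewrite eq_le.
have := pZ 0 0 (lexx _); have := pD 0 0; rewrite scale0r mul0r addr0.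
by move=> h1 h2; rewrite h2 /=; lra.
Qed.

Lemma sublinearN p x : sublinear p -> - p (- x) <= p x.
Proof.
move=> sp; have := sp.1 x (- x); rewrite subrr sublinear0//; lra.
Qed.

Lemma sublinearZ p t x : sublinear p -> 0 <= t -> p (t *: x) = t * p x.
Proof.
move=> sp; rewrite le_eqVlt => /predU1P[<-|t0].
  by rewrite scale0r mul0r sublinear0.
apply/eqP; rewrite eq_le (sp.2 _ _ (ltW t0))/= -ler_pdivlMl//.
have := sp.2 t^-1 (t *: x); rewrite scalerA mulVf ?gt_eqF// scale1r; apply.
by rewrite invr_ge0 ltW.
Qed.

(** This sublinear minorant of [p] is linear along the line through [y]. It serves twice: to attain
    [p y], and to show that minimal functionals are odd. *)
Definition sublinear_shift p y x : R :=
  inf [set p (x + t *: y) - t * p y | t in [set t | 0 <= t]].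

Lemma sublinear_shift_lb p y x : sublinear p ->
  lbound [set p (x + t *: y) - t * p y | t in [set t | 0 <= t]] (- p (- x)).
Proof.
move=> sp _ [t t0 <-]; have := sublinearZ y sp t0.
have := sp.1 (x + t *: y) (- x); rewrite addrAC subrr add0r; lra.
Qed.

Lemma sublinear_shift_le p y x t : sublinear p -> 0 <= t ->
  sublinear_shift p y x <= p (x + t *: y) - t * p y.
Proof.
move=> sp t0; apply: ge_inf; last by exists t.
by exists (- p (- x)); exact: sublinear_shift_lb.
Qed.

Lemma sublinear_shift_ge p y x r :
  (forall t, 0 <= t -> r <= p (x + t *: y) - t * p y) ->
  r <= sublinear_shift p y x.
Proof.
move=> h; apply: lb_le_inf; first by exists (p (x + 0 *: y) - 0 * p y), 0 => /=.
by move=> _ [t t0 <-]; exact: h.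
Qed.

Lemma sublinear_shiftP p y : sublinear p ->
  [/\ sublinear (sublinear_shift p y), forall x, sublinear_shift p y x <= p x &
      sublinear_shift p y (- y) <= - p y].
Proof.
move=> sp; split; last 2 first.
- move=> x; have := sublinear_shift_le y x sp (lexx 0).
  by rewrite scale0r addr0 mul0r subr0.
- have := sublinear_shift_le y (- y) sp ler01.
  by rewrite scale1r addNr sublinear0// mul1r sub0r.
split=> [x1 x2|t x].
  rewrite -lerBlDr; apply: sublinear_shift_ge => t1 t10.
  rewrite lerBlDr -lerBlDl; apply: sublinear_shift_ge => t2 t20.
  rewrite lerBlDl.
  have := sublinear_shift_le y (x1 + x2) sp (addr_ge0 t10 t20).
  have := sp.1 (x1 + t1 *: y) (x2 + t2 *: y).
  rewrite addrACA -scalerDl; lra.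
rewrite le_eqVlt => /predU1P[<-|t0].
  have := sublinear_shift_le y 0 sp (lexx 0).
  by rewrite !scale0r addr0 !mul0r subr0 (sublinear0 sp).
rewrite -ler_pdivrMl//; apply: sublinear_shift_ge => u u0.
rewrite ler_pdivrMl//.
have := sublinear_shift_le y (t *: x) sp (mulr_ge0 (ltW t0) u0).
have := sp.2 t (x + u *: y) (ltW t0).
rewrite scalerDr scalerA; lra.
Qed.

(* A minimal sublinear functional q is linear: minimality gives
   sublinear_shift q y = q, hence q (- y) <= - q y. *)
Lemma minimal_sublinear p : sublinear p ->
  exists q, [/\ sublinear q, forall x, q x <= p x &
    forall r, sublinear r -> (forall x, r x <= q x) -> r = q].
Proof.
move=> sp; pose T := {q : V -> R | sublinear q /\ forall x, q x <= p x}.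
pose Rel (a b : T) := `[< forall x, sval b x <= sval a x >].
pose p' : T := exist _ p (conj sp (fun x => lexx (p x))).
have [|||[q [sq qp]] /= qmin] := @ZL_preorder T p' Rel.
- by move=> a; apply/asboolP.
- move=> b a c /asboolP ab /asboolP bc; apply/asboolP => x.
  exact: le_trans (bc x) (ab x).
- move=> A Atot; have [[a0 Aa0]|A0] := pselect (A !=set0); last first.
    by exists p' => a Aa; exfalso; apply: A0; exists a.
  (* The pointwise infimum of a chain is finite since its members stay above [- p (- x)]. It is
     subadditive because, of two members, the smaller serves for both arguments. *)
  pose S x := [set sval a x | a in A].
  have Slb x : lbound (S x) (- p (- x)).
    move=> _ [a Aa <-]; have [sa ap] := svalP a.
    have := sublinearN x sa; have := ap (- x); lra.
  have S_le x a : A a -> inf (S x) <= sval a x.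
    by move=> Aa; apply: ge_inf; [exists (- p (- x)); exact: Slb|exists a].
  have S_ge x r : (forall a, A a -> r <= sval a x) -> r <= inf (S x).
    move=> h; apply: lb_le_inf; first by exists (sval a0 x), a0.
    by move=> _ [a Aa <-]; exact: h.
  have sinf : sublinear (fun x => inf (S x)).
    split=> [x y|t x].
      rewrite -lerBlDr; apply: (S_ge) => a Aa.
      rewrite lerBlDr -lerBlDl; apply: (S_ge) => b Ab; rewrite lerBlDl.
      have [/asboolP h|/asboolP h] := Atot _ _ Aa Ab.
        have := (svalP b).1.1 x y; have := h x; have := S_le (x + y) _ Ab; lra.
      have := (svalP a).1.1 x y; have := h y; have := S_le (x + y) _ Aa; lra.
    rewrite le_eqVlt => /predU1P[<-|t0].
      by rewrite scale0r mul0r; have := S_le 0 _ Aa0; rewrite (sublinear0 (svalP a0).1).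
    rewrite -ler_pdivrMl//; apply: S_ge => a Aa; rewrite ler_pdivrMl//.
    exact: le_trans (S_le _ _ Aa) ((svalP a).1.2 _ _ (ltW t0)).
  have infp x : inf (S x) <= p x.
    exact: le_trans (S_le _ _ Aa0) ((svalP a0).2 x).
  exists (exist _ (fun x => inf (S x)) (conj sinf infp)) => a Aa.
  by apply/asboolP => x /=; exact: S_le.
exists q; split=> // r sr rq; apply/funext => x; apply/eqP.
have rp y : r y <= p y by exact: le_trans (rq y) (qp y).
have /asboolP := qmin (exist _ r (conj sr rp)) (asboolT rq).
by rewrite eq_le rq => /(_ x).
Qed.

(** Minimizing below the shift of [p] gives q(-y) <= -p(y), which oddness turns into q(y) >=
    p(y). *)
Lemma hahn_banach p y : sublinear p ->
  exists F : V -> R, [/\ linear (F : V -> R^o), forall x, F x <= p x & F y = p y].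
Proof.
move=> sp; have [ssh shp shy] := sublinear_shiftP y sp.
have [q [sq qsh qmin]] := minimal_sublinear ssh.
have qN x : q (- x) = - q x.
  have [s1 s2 s3] := sublinear_shiftP x sq.
  have e := qmin _ s1 s2; rewrite e in s3.
  by apply/eqP; rewrite eq_le s3 /=; have := sublinearN x sq; lra.
have qD x z : q (x + z) = q x + q z.
  apply/eqP; rewrite eq_le sq.1 /=.
  have := sq.1 (x + z) (- z); rewrite addrK qN; lra.
have qZ0 t x : 0 <= t -> q (t *: x) = t * q x.
  move=> t0; apply/eqP; rewrite eq_le sq.2//=.
  have := sq.2 t (- x) t0; rewrite scalerN !qN; lra.
exists q; split.
- move=> t x z; rewrite qD; congr (_ + _).
  have [t0|t0] := leP 0 t; first exact: qZ0.
  have tN : 0 <= - t by rewrite oppr_ge0 ltW.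
  by have := qZ0 (- t) x tN; rewrite scaleNr qN mulNr => /oppr_inj.
- by move=> x; exact: le_trans (qsh x) (shp x).
- apply/eqP; rewrite eq_le (le_trans (qsh y) (shp y)) /=.
  have := qsh (- y); rewrite qN; lra.
Qed.

End HahnBanach.

(** * Weak* sequential compactness in reflexive spaces *)

(** An ultrafilter converges to each of its cluster points, and [-M, M] is compact. *)
Lemma bounded_ultra_cvg (R : realType) (U : set_system nat) (u : nat -> R) M :
  UltraFilter U -> (forall k, `|u k| <= M) -> exists l : R, u @ U --> l.
Proof.
move=> UU uM; have PU := @ultra_proper _ U UU.
have UM : (u @ U) `[- M, M]%classic.
  rewrite /fmap /=; apply: filterS filterT => k _ /=.
  by rewrite in_itv /= -ler_norml.
have [l [_ cl]] := @segment_compact R (- M) M (u @ U) _ UM.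
exists l => W Wl.
have [//|UnW] := in_ultra_setVsetC (u @^-1` W) UU.
by have [x [xnW xW]] := cl (~` W) W UnW Wl.
Qed.

(** Banach-Alaoglu along an ultrafilter: pointwise limits inherit linearity and the bound M |x|. *)
Lemma ultra_dual_cvg (R : realType) (X : normedModType R) (U : set_system nat)
    (f : nat -> dual X) M :
  UltraFilter U -> (forall k, `|f k| <= M) ->
  exists g : dual X, forall x, (fun k => f k x : R) @ U --> (g x : R).
Proof.
move=> UU fM; have PU := @ultra_proper _ U UU.
have fxM x k : `|f k x| <= M * `|x|.
  by rewrite (le_trans (dual_abs_le _ _))// ler_wpM2r.
have [g gP] := choice (fun x => bounded_ultra_cvg UU (fxM x)).
have lim_unique (u : nat -> R) (l l' : R) : u @ U --> l -> u @ U --> l' -> l = l'.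
  by apply: cvg_unique; exact: Rhausdorff.
have lg : linear (g : X -> R^o).
  move=> a x y; apply: lim_unique (gP _) _.
  have -> : (fun k => f k (a *: x + y)) = (fun k => a * f k x + f k y).
    by apply/funext => k; rewrite linearP.
  by apply: cvgD => //; exact: cvgMl_tmp.
have gM x : `|g x| <= M * `|x|.
  have := closed_cvg (fun t : R => t <= M * `|x|) (@closed_le _ _) _ _
    (cvg_norm (gP x)).
  by apply; apply: filterS filterT => k _.
pose g' : {linear X -> R^o} := HB.pack g (GRing.isLinear.Build _ _ _ _ g lg).
have cg : continuous (g : X -> R^o).
  apply: (@bounded_linear_continuous _ _ _ g').
  apply/linear_boundedP; exists M; split; first exact: num_real.
  by move=> N MN x; rewrite (le_trans (gM x))// ler_wpM2r// ltW.
by exists (Dual (asboolT (conj lg cg))).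
Qed.

Section rational_span.
Variables (R : realType) (V : normedModType R) (f : nat -> V).

(** Rational coefficients keep the family of combinations countable, as the diagonal extraction of
    subsequences requires. *)
Definition rat_comb (s : seq (rat * nat)) : V :=
  \sum_(x <- s) ratr x.1 *: f x.2.

Lemma rat_combD s t : rat_comb (s ++ t) = rat_comb s + rat_comb t.
Proof. exact: big_cat. Qed.

Lemma rat_combZ (q : rat) s :
  rat_comb [seq (q * x.1, x.2) | x <- s] = ratr q *: rat_comb s.
Proof.
rewrite /rat_comb big_map scaler_sumr; apply: eq_bigr => x _ /=.
by rewrite rmorphM /= scalerA.
Qed.

Lemma rat_comb1 k : rat_comb [:: (1, k)] = f k.
Proof. by rewrite /rat_comb big_seq1 rmorph1 scale1r. Qed.

Definition span_dist (x : V) : R := inf (range (fun s => `|x - rat_comb s|)).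

Lemma span_dist_le x s : span_dist x <= `|x - rat_comb s|.
Proof.
apply: ge_inf; last by exists s.
by exists 0 => _ [t _ <-].
Qed.

Lemma span_dist_ge x r : (forall s, r <= `|x - rat_comb s|) -> r <= span_dist x.
Proof.
move=> h; apply: lb_le_inf; first by exists `|x - rat_comb [::]|, [::].
by move=> _ [s _ <-].
Qed.

(** For homogeneity a real t > 0 is replaced by a rational q slightly above it, so close that (q -
    t) |rat_comb s| <= e. *)
Lemma span_dist_sublinear : sublinear span_dist.
Proof.
split=> [x y|t x t0].
  rewrite -lerBlDr; apply: span_dist_ge => s.
  rewrite lerBlDr -lerBlDl; apply: span_dist_ge => u; rewrite lerBlDl.
  rewrite (le_trans (span_dist_le _ (s ++ u)))// rat_combD opprD addrACA.
  exact: ler_normD.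
have [->|tn0] := eqVneq t 0.
  rewrite scale0r mul0r (le_trans (span_dist_le _ [::]))//.
  by rewrite /rat_comb big_nil subr0 normr0.
have tp : 0 < t by rewrite lt_neqAle eq_sym tn0.
rewrite -ler_pdivrMl//; apply: span_dist_ge => s; rewrite ler_pdivrMl//.
apply/ler_addgt0Pr => e e0.
have n0 : 0 < `|rat_comb s| + 1 by rewrite ltr_wpDl.
have tt : t < t + e / (`|rat_comb s| + 1) by rewrite ltrDl divr_gt0.
have [q] := rat_in_itvoo tt.
rewrite in_itv /= => /andP[tq qt].
rewrite (le_trans (span_dist_le _ [seq (q * x.1, x.2) | x <- s]))// rat_combZ.
have -> : t *: x - ratr q *: rat_comb s =
    t *: (x - rat_comb s) + (t - ratr q) *: rat_comb s.
  by rewrite scalerBr scalerBl addrA subrK.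
rewrite (le_trans (ler_normD _ _))// !normrZ (ger0_norm t0) lerD2l.
rewrite ltr0_norm ?subr_lt0// opprB.
apply: (@le_trans _ _ (e / (`|rat_comb s| + 1) * `|rat_comb s|)).
  by rewrite ler_wpM2r//; lra.
by rewrite mulrAC ler_pdivrMr// ler_pM2l// lerDl.
Qed.

End rational_span.

(* By Hahn-Banach and reflexivity, a functional vanishing on the common kernel
   of the f k lies in the norm closure of their span. *)
Lemma span_dist_reflexive (R : realType) (X : normedModType R)
    (f : nat -> dual X) (g : dual X) :
  reflexive_space X -> (forall x, (forall k, f k x = 0) -> g x = 0) ->
  span_dist f g = 0.
Proof.
move=> rX fg; have [F [lF Fp Fg]] := hahn_banach g (span_dist_sublinear f).
have F_comb s : F (rat_comb f s) <= 0.
  by rewrite (le_trans (Fp _))// (le_trans (span_dist_le _ _ s))// subrr normr0.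
have Fnorm h : F h <= `|h|.
  rewrite (le_trans (Fp _))// (le_trans (span_dist_le _ _ [::]))//.
  by rewrite /rat_comb big_nil subr0.
pose F' : {linear (dual X) -> R^o} := HB.pack F (GRing.isLinear.Build _ _ _ _ F lF).
have FN h : F (- h) = - F h by exact: (linearN F').
have cF : continuous (F : dual X -> R^o).
  apply: (@bounded_linear_continuous _ _ _ F').
  apply/linear_boundedP; exists 1; split; first exact: num_real.
  move=> N N1 h; apply: (@le_trans _ _ `|h|); last by rewrite ler_peMl// ltW.
  rewrite ler_norml Fnorm andbT lerNl -FN (le_trans (Fnorm _))// normrN.
  exact: lexx.
(* Reflexivity represents [F] by a point [x]. As [F] is nonpositive on all rational combinations,
   including plus and minus [f k], every [f k] vanishes at [x]. *)
have [x xP] := rX (Dual (asboolT (conj lF cF))).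
have Fx h : F h = h x by exact: xP h.
rewrite -Fg Fx; apply: fg => k; rewrite -Fx.
apply/eqP; rewrite eq_le; apply/andP; split.
  by rewrite -(rat_comb1 f k).
have := F_comb [seq (-1 * x.1, x.2) | x <- [:: (1, k)]].
by rewrite rat_combZ rat_comb1 rmorphN1 scaleN1r FN oppr_le0.
Qed.

Lemma dual_almost_norming (R : realType) (X : normedModType R) (v : dual X) :
  exists x, `|x| <= 1 /\ `|v| <= 2 * `|v x|.
Proof.
have [->|v0] := eqVneq v 0; first by exists 0; rewrite !normr0 mulr0.
apply: contrapT => /forallNP h.
have : `|v| <= `|v| / 2.
  apply: dual_norm_le => x x1; rewrite leNgt; apply/negP => lt.
  by apply: (h x); split=> //; rewrite -ler_pdivrMl// mulrC ltW.
have : 0 < `|v| by rewrite normr_gt0.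
lra.
Qed.

(** Every set of the filter meets every tail, so the indices can be chosen one after the other. *)
Lemma free_filter_subseq (U : set_system nat) (P : nat -> nat -> Prop) :
  ProperFilter U -> \oo `<=` U -> (forall j, U (P j)) ->
  exists s : nat -> nat, {homo s : m n / (m < n)%N} /\ forall j, P j (s j).
Proof.
move=> PU ooU UP.
have step (nj : nat * nat) : exists k, (nj.1 < k)%N /\ P nj.2 k.
  have : U ([set k | (nj.1 < k)%N] `&` P nj.2).
    by apply: filterI => //; apply: ooU; exists nj.1.+1.
  by move=> /filter_ex[k []]; exists k.
have [F FP] := choice step.
pose s := fix s j := if j is j'.+1 then F (s j', j) else F (0, 0)%N.
exists s; split; last by case=> [|j]; [exact: (FP (0, 0)%N).2|exact: (FP (s j, j.+1)).2].
by apply: homo_ltn; [exact: ltn_trans|move=> j; exact: (FP _).1].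
Qed.

(* Eberlein-Smulian: along an ultrafilter f converges weak* to some g; a
   subsequence converges to g on a countable set norming the closed span of
   f, which contains the difference of any two weak* cluster points. *)
Lemma weak_star_seq_compact (R : realType) (X : normedModType R)
    (f : nat -> dual X) (M : R) :
  reflexive_space X -> (forall k, `|f k| <= M) ->
  exists (s : nat -> nat) (g : dual X),
    {homo s : m n / (m < n)%N} /\ weak_star_cvg (f \o s) g.
Proof.
move=> rX fM.
have [U [UU ooU]] := ultraFilterLemma (eventually_filter).
have PU := @ultra_proper _ U UU.
have [g gP] := ultra_dual_cvg UU fM.
have [d dP] := choice (fun t => dual_almost_norming (rat_comb f t)).
(* [D] enumerates almost norming points of all rational combinations; the default 0 at codes of
   nothing is harmless. *)
pose D n := if unpickle n is Some t then d t else 0.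
have UD j : U [set k | forall n, (n <= j)%N -> `|f k (D n) - g (D n)| <= j.+1%:R^-1].
  have Un n : U [set k | `|f k (D n) - g (D n)| <= j.+1%:R^-1].
    have /cvgrPdist_le/(_ j.+1%:R^-1) := gP (D n).
    rewrite invr_gt0 ltr0n => /(_ isT); apply: filterS => k.
    by rewrite distrC.
  suff H i : U [set k | forall n, (n < i)%N -> `|f k (D n) - g (D n)| <= j.+1%:R^-1].
    exact: H j.+1.
  elim: i => [|i IH]; first by apply: filterS filterT.
  apply: filterS (filterI IH (Un i)) => k [h1 h2] n.
  by rewrite ltnS leq_eqVlt => /predU1P[->//|]; exact: h1.
have [s [s_incr sP]] := free_filter_subseq PU ooU UD.
exists s, g; split=> // x0.
apply: contrapT => ncvg.
have [e e0 bad] : exists2 e, 0 < e & forall N, exists2 j, (N <= j)%N &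
    e < `|f (s j) x0 - g x0|.
  apply: contrapT => nbad; apply: ncvg.
  apply/(cvgn_distP ((fun k => f (s k) x0) : nat -> R^o)) => e e0.
  apply: contrapT => nN; apply: nbad; exists e => // N.
  apply: contrapT => nj; apply: nN; exists N => n Nn; rewrite leNgt.
  by apply/negP => lt; apply: nj; exists n.
(* An ultrafilter on the bad indices produces a second weak* limit [h], which differs from [g] at
   [x0]. *)
pose W := within [set j | e < `|f (s j) x0 - g x0|] (\oo : set_system nat).
have WP : ProperFilter W.
  split; last exact: within_filter.
  by move=> [N _ NW]; have [j Nj ej] := bad N; exact: (NW j Nj ej).
have [U' [UU' WU']] := ultraFilterLemma WP.
have PU' := @ultra_proper _ U' UU'.
have ooU' : \oo `<=` U'.
  by move=> A A_oo; apply: WU'; apply: filterS A_oo => j Aj _.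
have [h hP] := ultra_dual_cvg UU' (fun k => fM (s k)).
have hx0 : e <= `|h x0 - g x0|.
  have := closed_cvg (fun t : R => e <= t) (@closed_ge _ _) _ _
    (cvg_norm (cvgB (hP x0) (cvg_cst (g x0)))).
  by apply; apply: WU'; rewrite /W /within /=; apply: filterS filterT => j _ /ltW.
have lim_unique (u : nat -> R) (l l' : R) : u @ U' --> l -> u @ U' --> l' -> l = l'.
  by apply: cvg_unique; exact: Rhausdorff.
have hD n : h (D n) = g (D n).
  apply: lim_unique (hP _) _; apply: (@cvg_trans _ ((fun j => f (s j) (D n) : R) @ \oo)).
    by move=> A /ooU'.
  apply/(cvgn_distP ((fun k => f (s k) (D n)) : nat -> R^o)) => e' e'0.
  have [N _ hN] := near_infty_natSinv_lt (PosNum e'0).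
  exists (maxn N n) => j; rewrite geq_max => /andP[Nj nj].
  by rewrite (le_trans (sP j n nj))// ltW//; exact: (hN j Nj).
have hg0 : span_dist f (h - g) = 0.
  apply: span_dist_reflexive => // x fx0.
  have cst0 (F : set_system nat) (t : nat -> nat) : Filter F ->
      (fun k => f (t k) x : R) @ F --> (0 : R).
    move=> FF; have -> : (fun k => f (t k) x : R) = (fun=> 0).
      by apply/funext => k; rewrite fx0.
    exact: cvg_cst.
  have hx : h x = 0 by apply: lim_unique (hP x) _; exact: cst0.
  have gx : g x = 0.
    by apply: (cvg_unique (@Rhausdorff R) (gP x)); exact: (cst0 _ id).
  by rewrite (_ : (h - g) x = h x - g x)// hx gx subrr.
(* Take a combination t within e'/3 of h - g. Since h - g vanishes at the point norming t up to a
   factor 2, |t| <= 2e'/3, and the total is e'. *)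
have : `|h - g| <= 0.
  apply/ler_addgt0Pr => e' e'0; rewrite add0r.
  have e30 : 0 < e' / 3 by rewrite divr_gt0.
  have [t ht] : exists t, `|h - g - rat_comb f t| < e' / 3.
    apply: contrapT => /forallNP nt.
    have := @span_dist_ge _ _ f (h - g) (e' / 3); rewrite hg0 leNgt e30 /=.
    by move=> H; suff: false by []; apply: H => t; rewrite leNgt; apply/negP/nt.
  have [d1 d2] := dP t.
  have hgd : h (d t) = g (d t) by have := hD (pickle t); rewrite /D pickleK.
  have h3 : `|rat_comb f t (d t)| <= `|h - g - rat_comb f t|.
    have -> : rat_comb f t (d t) = - (h - g - rat_comb f t) (d t).
      rewrite (_ : (h - g - rat_comb f t) (d t) =
        h (d t) - g (d t) - rat_comb f t (d t))//.
      by rewrite hgd subrr sub0r opprK.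
    by rewrite normrN (le_trans (dual_abs_le _ _))// ler_piMr.
  have := ler_normD (h - g - rat_comb f t) (rat_comb f t); rewrite subrK.
  lra.
rewrite normr_le0 subr_eq0 => /eqP hg.
by move: hx0; rewrite hg subrr normr0 leNgt e0.
Qed.

(** * Sequences of approximate normals *)

Section sequences.
Variable R : realType.

Lemma incr_ge (s : nat -> nat) : {homo s : m n / (m < n)%N} ->
  forall k, (k <= s k)%N.
Proof. by move=> hs; elim=> // k /leq_ltn_trans; apply; exact: hs. Qed.

Lemma cvg_incr (V : normedModType R) (u : nat -> V) (l : V) (s : nat -> nat) :
  {homo s : m n / (m < n)%N} -> u @ \oo --> l -> (u \o s) @ \oo --> l.
Proof.
move=> /incr_ge hs /cvgn_distP ul; apply/cvgn_distP => e /ul[N uN].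
by exists N => n Nn; apply: uN; exact: leq_trans Nn (hs n).
Qed.

Lemma cvg0_dist (V : normedModType R) (u v : nat -> V) (r : nat -> R) (l : V) :
  (forall k, `|u k - v k| <= r k) -> r @ \oo --> (0 : R) -> v @ \oo --> l ->
  u @ \oo --> l.
Proof.
move=> uv /(cvgn_distP (r : nat -> R^o)) r0 /cvgn_distP vl.
apply/cvgn_distP => e e0.
have [N1 h1] := r0 _ (divr_gt0 e0 (ltr0Sn _ 1)).
have [N2 h2] := vl _ (divr_gt0 e0 (ltr0Sn _ 1)).
exists (maxn N1 N2) => n; rewrite geq_max => /andP[n1 n2].
have := ler_normD (u n - v n) (v n - l); rewrite addrA subrK => h.
rewrite (le_trans h)// [leRHS]splitr lerD ?h2//.
rewrite (le_trans (uv n))// (le_trans (ler_norm _))//.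
by have := h1 n n1; rewrite subr0.
Qed.

Lemma dichotomy (r : nat -> R) : (forall k, 0 <= r k) ->
  r @ \oo --> (0 : R) \/ exists (c : R) (s : nat -> nat),
    [/\ 0 < c, {homo s : m n / (m < n)%N} & forall k, c <= r (s k)].
Proof.
move=> r0; have [|h] := pselect (r @ \oo --> (0 : R)); [by left|right].
have [c c0 bad] : exists2 c, 0 < c & forall N, exists2 k, (N <= k)%N & c <= r k.
  apply: contrapT => nbad; apply: h.
  apply/(cvgn_distP (r : nat -> R^o)) => e e0.
  apply: contrapT => nN; apply: nbad; exists e => // N.
  apply: contrapT => nk; apply: nN; exists N => n Nn.
  rewrite subr0 ger0_norm// leNgt; apply/negP => lt.
  by apply: nk; exists n => //; exact: ltW.
have step (n : nat) : exists k, (n < k)%N /\ c <= r k.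
  by have [k nk ck] := bad n.+1; exists k.
have [F FP] := choice step.
exists c, (fun n => iter n.+1 F 0%N); split=> //.
  by apply: homo_ltn => [|n]; [exact: ltn_trans|exact: (FP _).1].
by move=> k; exact: (FP _).2.
Qed.

Lemma weak_star_incr (X : normedModType R) (f : nat -> dual X) g s :
  {homo s : m n / (m < n)%N} -> weak_star_cvg f g -> weak_star_cvg (f \o s) g.
Proof. by move=> hs fg x; apply: (@cvg_incr R^o _ _ _ hs (fg x)). Qed.

Lemma cvg_weak_star (X : normedModType R) (f : nat -> dual X) (g : dual X) :
  f @ \oo --> g -> weak_star_cvg f g.
Proof.
move=> fg x; apply: (@cvg0_dist R^o _ (fun=> g x) (fun k => `|f k - g| * `|x|)).
- by move=> k; exact: (dual_abs_le (f k - g) x).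
- rewrite -[X in _ --> X](mul0r `|x|); apply: cvgMr_tmp.
  apply/(cvgn_distP ((fun k => `|f k - g|) : nat -> R^o)) => e e0.
  have [N fN] := (cvgn_distP _ _).1 fg e e0.
  by exists N => n Nn; rewrite subr0 normr_id; exact: fN.
- exact: cvg_cst.
Qed.

Lemma weak_star_dist (X : normedModType R) (f f' : nat -> dual X) g (r : nat -> R) :
  (forall k, `|f' k - f k| <= r k) -> r @ \oo --> (0 : R) ->
  weak_star_cvg f g -> weak_star_cvg f' g.
Proof.
move=> ff' r0 fg x.
apply: (@cvg0_dist R^o _ (fun k => f k x) (fun k => r k * `|x|)) (fg x).
- move=> k; rewrite (le_trans (dual_abs_le (f' k - f k) x))//.
  by rewrite ler_wpM2r.
- by rewrite -[X in _ --> X](mul0r `|x|); apply: cvgMr_tmp.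
Qed.

Lemma weak_star_unique (X : normedModType R) (f : nat -> dual X) g h :
  weak_star_cvg f g -> weak_star_cvg f h -> g = h.
Proof.
move=> fg fh; apply/val_inj/funext => x.
by apply: (cvg_unique (@Rhausdorff R) (fg x)); exact: fh.
Qed.

(** Uniform boundedness principle: each sequence of values converges, hence is bounded. *)
Lemma weak_star_bounded (X : completeNormedModType R) (f : nat -> dual X) g :
  weak_star_cvg f g -> exists2 M, 0 <= M & forall k, `|f k| <= M.
Proof.
move=> fg; pose F : set (X -> R^o) := range (fun k => f k : X -> R^o).
have [||M FM] := @Banach_Steinhauss R X R^o F _ _ 1.
- move=> _ [k _ <-]; split; last exact: dual_linear.
  move=> r; exists (`|f k| * r) => x xr.
  by rewrite (le_trans (dual_abs_le _ _))// ler_wpM2l.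
- move=> x; have cx : cvgn ((fun k => f k x) : nat -> R^o).
    by apply/cvg_ex; exists (g x); exact: fg.
  have [M [_ MP]] := cvg_seq_bounded cx.
  by exists (M + 1) => _ [k _ <-]; apply: MP => //; rewrite ltrDl.
have fM k : `|f k| <= M.
  by apply: dual_norm_le => x x1; apply: FM => //; exists k.
by exists M => //; exact: le_trans (fM 0%N).
Qed.

End sequences.

(** * Comparison of relative and absolute normality errors *)

Section normals.
Variables (R : realType) (U V : normedModType R).

Lemma l2norm_ge (A B : normedModType R) (q : A * B) : `|q| <= l2norm q.
Proof.
apply: norm_pair_le; rewrite /l2norm -[leLHS]ger0_norm// -sqrtr_sqr ler_sqrt.
- by rewrite lerDl sqr_ge0.
- by rewrite addr_ge0// sqr_ge0.
- by rewrite lerDr sqr_ge0.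
- by rewrite addr_ge0// sqr_ge0.
Qed.

Lemma l2norm_le (A B : normedModType R) (q : A * B) : l2norm q <= 2 * `|q|.
Proof.
rewrite /l2norm -[leRHS]ger0_norm ?mulr_ge0// -sqrtr_sqr ler_sqrt ?sqr_ge0//.
have : `|q.1| ^+ 2 <= `|q| ^+ 2 by rewrite ler_sqr ?nnegrE// norm_fst_le.
have : `|q.2| ^+ 2 <= `|q| ^+ 2 by rewrite ler_sqr ?nnegrE// norm_snd_le.
have := sqr_ge0 `|q|; rewrite exprMn; lra.
Qed.

(** Passing from Euclidean to max norms costs a factor 2 for the functionals and a factor 2 for the
    displacement, hence the 4. *)
Lemma abs_normal_of_eps e (L : set (U * V)) w f g M :
  0 <= e -> `|f| <= M -> `|g| <= M -> eps_normal e L w (f, g) ->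
  abs_normal (4 * e * M) L w f g.
Proof.
move=> e0 fM gM; rewrite /eps_normal /= limf_esupE => h e' e'0.
have M0 : 0 <= M by exact: le_trans fM.
have qM : l2norm (f, g) <= 2 * M.
  by rewrite (le_trans (l2norm_le _))// ler_pM2l// norm_pair_le.
have e20 : 0 < e' / 2 by rewrite divr_gt0.
have : (limf_esup (fun u : U * V =>
      ((f (u.1 - w.1) + g (u.2 - w.2)) / l2norm (u - w))%:E)
      (within L w^') < (e * l2norm (f, g) + e' / 2)%:E)%E.
  by rewrite limf_esupE; apply: le_lt_trans h _; rewrite lte_fin ltrDl.
rewrite limf_esupE => /ereal_inf_lt[_ [W WL <-] supW].
have /nbhs_normP[d /= d0 dW] : \forall u \near w, u != w -> L u -> W u by exact: WL.
exists (d / 2); first by rewrite divr_gt0.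
move=> u Lu ud; have [->|uw] := eqVneq u w.
  by rewrite !subrr !linear0 addr0 normr0 mulr0.
have Wu : W u.
  apply: dW => //=; rewrite -normrN opprB (le_lt_trans ud)//.
  by rewrite gtr_pMr// invf_lt1// ltr1n.
have n0 : 0 < l2norm (u - w).
  by rewrite (lt_le_trans _ (l2norm_ge _))// normr_gt0 subr_eq0.
have : (((f (u.1 - w.1) + g (u.2 - w.2)) / l2norm (u - w))%:E <
    (e * l2norm (f, g) + e' / 2)%:E)%E.
  by apply: le_lt_trans supW; apply: ereal_sup_ubound; exists u.
rewrite lte_fin ltr_pdivrMr// => /ltW/le_trans; apply.
have h1 : e * l2norm (f, g) <= e * (2 * M) by rewrite ler_wpM2l.
apply: (@le_trans _ _ ((e * (2 * M) + e' / 2) * (2 * `|u - w|))); last first.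
  by rewrite le_eqVlt; apply/orP; left; apply/eqP; field.
apply: ler_pM; rewrite ?lerD2r ?l2norm_le ?(ltW n0)//.
by rewrite addr_ge0 ?(ltW e20)// mulr_ge0// sqrtr_ge0.
Qed.

(** The max norm is below the Euclidean one for functionals and displacements alike, so no constant
    is lost. *)
Lemma eps_normal_of_abs e b (L : set (U * V)) w f g :
  0 <= b -> b <= e * `|(f, g)| -> 0 <= e -> abs_normal b L w f g ->
  eps_normal e L w (f, g).
Proof.
move=> b0 be e0 h; rewrite /eps_normal /= limf_esupE.
apply/lee_addgt0Pr => e' e'0; have [d d0 dP] := h e' e'0.
pose W := [set u | L u /\ (u != w /\ `|u - w| <= d)].
apply: (@le_trans _ _ (ereal_sup
  [set ((f (u.1 - w.1) + g (u.2 - w.2)) / l2norm (u - w))%:E | u in W])).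
  apply: ereal_inf_lbound; exists W => //.
  suff : \forall u \near w, u != w -> L u -> W u by [].
  apply/nbhs_normP; exists d => //= u ud uw Lu; split=> //; split=> //.
  by rewrite -normrN opprB ltW.
apply: ge_ereal_sup => _ [u [Lu [uw ud]] <-].
have n0 : 0 < l2norm (u - w).
  by rewrite (lt_le_trans _ (l2norm_ge _))// normr_gt0 subr_eq0.
rewrite -EFinD lee_fin ler_pdivrMr// (le_trans (dP u Lu ud))//.
apply: ler_pM => //; [by rewrite addr_ge0// ltW| |exact: l2norm_ge].
by rewrite lerD2r (le_trans be)// ler_wpM2l// l2norm_ge.
Qed.

Lemma abs_normalZ a b (L : set (U * V)) w f g :
  0 < a -> abs_normal b L w f g -> abs_normal (a * b) L w (a *: f) (a *: g).
Proof.
move=> a0 h e e0; have [d d0 dP] := h (e / a) (divr_gt0 e0 a0).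
exists d => // u Lu ud; rewrite !dualZ -mulrDr.
have -> : (a * b + e) * `|u - w| = a * ((b + e / a) * `|u - w|).
  by field; rewrite gt_eqF.
by rewrite ler_pM2l// dP.
Qed.

Lemma abs_normal_dist b r (L : set (U * V)) w f f' g :
  `|f' - f| <= r -> abs_normal b L w f g -> abs_normal (b + r) L w f' g.
Proof.
move=> ff' h e /h[d d0 dP]; exists d => // u Lu ud.
have := dP u Lu ud; have := dual_ler (f' - f) (u.1 - w.1).
rewrite (_ : (f' - f) (u.1 - w.1) = f' (u.1 - w.1) - f (u.1 - w.1))//.
have := ler_pM (normr_ge0 _) (normr_ge0 _) ff' (norm_fst_le (u - w)).
rewrite (_ : (u - w).1 = u.1 - w.1)//; lra.
Qed.

Lemma abs_normal_le b b' (L : set (U * V)) w f g :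
  b <= b' -> abs_normal b L w f g -> abs_normal b' L w f g.
Proof.
move=> bb' h e /h[d d0 dP]; exists d => // u Lu ud.
by rewrite (le_trans (dP u Lu ud))// ler_wpM2r// lerD2r.
Qed.

Lemma abs_normal_local b (L W : set (U * V)) w f g r :
  0 < r -> (forall u, `|u - w| <= r -> W u) ->
  abs_normal b (L `&` W) w f g -> abs_normal b L w f g.
Proof.
move=> r0 rW h e /h[d d0 dP]; exists (Num.min d r).
  by rewrite lt_min d0.
move=> u Lu; rewrite le_min => /andP[ud ur]; apply: dP => //.
by split=> //; exact: rW.
Qed.

(** Functionals bounded below by [c] turn the absolute errors [b k] into relative errors
    [b k / c]. *)
Lemma normal_sequence_of_abs (b : nat -> R) (c : R) (L : set (U * V)) w u fs gs :
  0 < c -> (forall k, 0 <= b k) -> b @ \oo --> (0 : R) ->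
  (forall k, L (u k)) -> u @ \oo --> w ->
  (forall k, c <= `|(fs k, gs k)|) ->
  (forall k, abs_normal (b k) L (u k) (fs k) (- gs k)) ->
  exists eps, normal_sequence L w eps u fs gs.
Proof.
move=> c0 b0 b_cvg Lu uw cq h; exists (fun k => b k / c).
have bc k : 0 <= b k / c by rewrite divr_ge0// ltW.
split=> //; first split=> //.
  by rewrite -(mul0r c^-1); apply: cvgMr_tmp.
move=> k; apply: eps_normal_of_abs (b0 k) _ (bc k) (h k).
have -> : `|(fs k, - gs k)| = `|(fs k, gs k)|.
  by rewrite !prod_normE /= normrN.
by rewrite mulrAC ler_pdivlMr// ler_wpM2l.
Qed.

Lemma normal_sequence0 (L : set (U * V)) w : L w ->
  normal_sequence L w (fun=> 0) (fun=> w) (fun=> 0) (fun=> 0).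
Proof.
move=> Lw; split=> //; [by split=> //; apply: cvg_cst|exact: cvg_cst|].
move=> _; apply: (@eps_normal_of_abs 0 0); rewrite ?mul0r//.
move=> e e0; exists 1 => // u _ _.
rewrite oppr0 [X in X <= _](_ : _ = 0 + 0)//.
by rewrite addr0 add0r mulr_ge0// ltW.
Qed.

(* Conic normality controls the error relatively to the norm of the functionals:
   after passing to a subsequence, either this norm is bounded away from zero or
   the limit is zero, in which case the zero sequence serves as well. *)
Lemma normal_sequence_limit (b : nat -> R) (L : set (U * V)) w u fs gs f g :
  (forall k, 0 <= b k) -> b @ \oo --> (0 : R) ->
  (forall k, L (u k)) -> L w -> u @ \oo --> w ->
  (forall k, abs_normal (b k) L (u k) (fs k) (- gs k)) ->
  weak_star_cvg fs f -> weak_star_cvg gs g ->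
  exists (s : nat -> nat) eps, {homo s : m n / (m < n)%N} /\
    (normal_sequence L w eps (u \o s) (fs \o s) (gs \o s) \/
     f = 0 /\ g = 0).
Proof.
move=> b0 b_cvg Lu Lw uw h fsf gsg.
have [q0|[c [s [c0 sincr qs]]]] := dichotomy (fun k => normr_ge0 (fs k, gs k)).
  exists id, b; split=> //; right; split.
    apply: (weak_star_unique fsf); apply: (weak_star_dist _ q0 (f := fun=> 0)).
      by move=> k; rewrite subr0; exact: (norm_fst_le (fs k, gs k)).
    by move=> x; apply: cvg_cst.
  apply: (weak_star_unique gsg); apply: (weak_star_dist _ q0 (f := fun=> 0)).
    by move=> k; rewrite subr0; exact: (norm_snd_le (fs k, gs k)).
  by move=> x; apply: cvg_cst.
have [] := @normal_sequence_of_abs (b \o s) c L w (u \o s) (fs \o s) (gs \o s) => //.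
- by move=> k; exact: b0.
- exact: (@cvg_incr R R^o b 0 s sincr b_cvg).
- by move=> k; exact: Lu.
- exact: cvg_incr.
- by move=> k; exact: h.
- by move=> eps neps; exists s, eps; split=> //; left.
Qed.

End normals.

Lemma abs_normal_swap (R : realType) (U V : normedModType R) (b : R)
    (L : set (U * V)) (w : U * V) f g :
  abs_normal b L w f g ->
  abs_normal b [set p : V * U | L (p.2, p.1)] (w.2, w.1) g f.
Proof.
move=> h e /h[d d0 dP]; exists d => // u Lu ud.
have n : `|u - (w.2, w.1)| = `|(u.2, u.1) - w|.
  by rewrite [LHS]prod_normE [RHS]prod_normE /= maxC.
by rewrite addrC n; apply: (dP (u.2, u.1)) => //; rewrite -n.
Qed.

(** * Local and relative forms of the fuzzy intersection rule *)

Lemma locally_closed_near (R : realType) (U : normedModType R) (A : set U) w :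
  locally_closed_at A w -> exists2 r, 0 < r &
    forall w', `|w' - w| <= r -> locally_closed_at A w'.
Proof.
move=> [V [/nbhs_interior/nbhs_normP[r /= r0 rV] cV cAV]].
exists (r / 2); first by rewrite divr_gt0.
move=> w' w'w; exists V; split=> //; apply: rV => /=.
by rewrite distrC (le_lt_trans w'w)// gtr_pMr// invf_lt1// ltr1n.
Qed.

Lemma locally_closed_graph_on (R : realType) (U V : normedModType R)
    (F : U -> set V) (Omega : set U) w :
  closed Omega -> locally_closed_at (graph F) w ->
  locally_closed_at (graph_on F Omega) w.
Proof.
move=> cO [W [Ww cW cFW]]; exists W; split=> //.
have -> : graph_on F Omega `&` W = (fst @^-1` Omega) `&` (graph F `&` W).
  by apply/seteqP; split=> [p [[? ?] ?]|p [? [? ?]]].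
apply: closedI => //; apply: closed_comp => // p _; exact: cvg_fst.
Qed.

(** Apply [fuzzy_core] to the closed traces of the sets on [V] and [W], with [r] so small that balls
    of radius r/2 around the points found stay in [V] and [W]. Half of [e] absorbs the slack in [h];
    the other half is the Ekeland slope. *)
Lemma fuzzy_intersection (R : realType) (X Y Z : normedModType R)
    (A : set (X * Y)) (B : set (Y * Z)) (x0 : X) (y0 : Y) (z0 : Z)
    (f : dual X) (g : dual Z) (b : R) :
  frechet_smooth_norm Y -> seq_complete X -> seq_complete Y -> seq_complete Z ->
  A (x0, y0) -> B (y0, z0) ->
  locally_closed_at A (x0, y0) -> locally_closed_at B (y0, z0) ->
  0 <= b -> abs_normal b (relcomp A B) (x0, z0) f (- g) ->
  forall e, 0 < e -> exists (w1 : X * Y) (w2 : Y * Z) (mu : R) (k : dual Y),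
  [/\ A w1 /\ B w2, `|w1 - (x0, y0)| <= e /\ `|w2 - (y0, z0)| <= e,
      0 <= mu /\ mu ^+ 2 + `|k| ^+ 2 = 1,
      abs_normal (b + e) A w1 (mu *: f) (- k) &
      abs_normal (b + e) B w2 k (- (mu *: g))].
Proof.
move=> smY cX cY cZ Axy Byz [V [Vxy cV cAV]] [W [Wyz cW cBW]] b0 h e e0.
have e20 : 0 < e / 2 by rewrite divr_gt0.
have [d d0 dP] := h _ e20.
have /nbhs_normP[r1 /= r10 r1V] := Vxy.
have /nbhs_normP[r2 /= r20 r2W] := Wyz.
pose r := Num.min (Num.min d e) (Num.min (r1 / 2) (r2 / 2)).
have r0 : 0 < r by rewrite !lt_min d0 e0 !divr_gt0.
have [rd re] : r <= d /\ r <= e.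
  by split; rewrite /r !ge_min lexx ?orbT.
have [rr1 rr2] : r <= r1 / 2 /\ r <= r2 / 2.
  by split; rewrite /r !ge_min lexx ?orbT.
have AV : (A `&` V) (x0, y0) by split=> //; exact: nbhs_singleton.
have BW : (B `&` W) (y0, z0) by split=> //; exact: nbhs_singleton.
have fgP u : relcomp (A `&` V) (B `&` W) u -> `|u - (x0, z0)| <= r ->
    f (u.1 - x0) - g (u.2 - z0) <= (b + e / 2) * `|u - (x0, z0)|.
  move=> [y [[Ay _] [By _]]] ur; apply: (dP u) (le_trans ur rd).
  by exists y.
have be0 : 0 <= b + e / 2 by rewrite addr_ge0// ltW.
have [w1 [w2 [mu [k [[[Aw1 _] [Bw2 _]] [n1 n2] muk N1 N2]]]]] :=
  fuzzy_core smY cX cY cZ AV BW cAV cBW be0 r0 e20 fgP.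
have r2e : r / 2 <= e by rewrite (le_trans _ re)// ler_pdivrMr// ler_pMr// ler1n.
have ext (T : normedModType R) (S : set T) (t0 w : T) rho :
    (forall u, `|t0 - u| < rho -> S u) -> r <= rho / 2 -> `|w - t0| <= r / 2 ->
    forall u, `|u - w| <= r / 2 -> S u.
  move=> Srho rrho wt u uw; apply: Srho.
  have := ler_normD (u - w) (w - t0); rewrite addrA subrK distrC; lra.
exists w1, w2, mu, k; split=> //.
- by split; [exact: le_trans n1 _|exact: le_trans n2 _].
- have -> : b + e = b + e / 2 + e / 2 by rewrite -addrA -splitr.
  apply: abs_normal_local N1; first exact: (divr_gt0 r0 (ltr0Sn _ 1)).
  exact: ext r1V rr1 n1.
- have -> : b + e = b + e / 2 + e / 2 by rewrite -addrA -splitr.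
  apply: abs_normal_local N2; first exact: (divr_gt0 r0 (ltr0Sn _ 1)).
  exact: ext r2W rr2 n2.
Qed.

(** Since mu <= 1, replacing [f] by a functional [f'] in the duality image at the new point adds at
    most |f' - f| to the error. *)
Lemma fuzzy_relative (R : realType) (X Y Z : normedModType R)
    (Omega : set X) (S1 : X -> set Y) (B : set (Y * Z)) (x0 : X) (y0 : Y) (z0 : Z)
    (f : dual X) (g : dual Z) (b : R) :
  frechet_smooth_norm X -> frechet_smooth_norm Y ->
  seq_complete X -> seq_complete Y -> seq_complete Z -> convex_set Omega ->
  graph_on S1 Omega (x0, y0) -> B (y0, z0) ->
  locally_closed_at (graph_on S1 Omega) (x0, y0) -> locally_closed_at B (y0, z0) ->
  0 <= b -> abs_normal b (relcomp (graph_on S1 Omega) B) (x0, z0) f (- g) ->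
  duality_image (tangent_cone Omega x0) f ->
  forall e, 0 < e ->
  exists (w1 : X * Y) (w2 : Y * Z) (mu : R) (k : dual Y) (f' : dual X),
  [/\ graph_on S1 Omega w1 /\ B w2,
      `|w1 - (x0, y0)| <= e /\ `|w2 - (y0, z0)| <= e,
      0 <= mu /\ mu ^+ 2 + `|k| ^+ 2 = 1,
      duality_image (tangent_cone Omega w1.1) f' /\ `|f' - f| <= e &
      abs_normal (b + e) (graph_on S1 Omega) w1 (mu *: f') (- k) /\
      abs_normal (b + e) B w2 k (- (mu *: g))].
Proof.
move=> smX smY cX cY cZ cO Axy Byz lA lB b0 h Jf e e0.
have e20 : 0 < e / 2 by rewrite divr_gt0.
have [d d0 dP] := duality_tangent_lsc smX cO Jf e20.
have m0 : 0 < Num.min (e / 2) d by rewrite lt_min e20.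
have [me md] : Num.min (e / 2) d <= e / 2 /\ Num.min (e / 2) d <= d.
  by split; rewrite ge_min lexx ?orbT.
have [w1 [w2 [mu [k [[Aw1 Bw2] [n1 n2] [mu0 muk] N1 N2]]]]] :=
  fuzzy_intersection smY cX cY cZ Axy Byz lA lB b0 h m0.
have w1d : `|w1.1 - x0| <= d.
  by rewrite (le_trans (norm_fst_le (w1 - (x0, y0))))// (le_trans n1).
have [f' Jf' f'f] := dP w1.1 Aw1.1 w1d.
have mu1 : mu <= 1.
  rewrite -(@ler_pXn2r _ 2) ?nnegrE// expr1n -muk lerDl sqr_ge0//.
exists w1, w2, mu, k, f'; split=> //.
- by split; [apply: le_trans n1 _|apply: le_trans n2 _]; lra.
- by split=> //; lra.
- split; last by apply: abs_normal_le N2; lra.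
  apply: (@abs_normal_le _ _ _ (b + Num.min (e / 2) d + e / 2)); first lra.
  apply: abs_normal_dist N1.
  rewrite -scalerBr normrZ ger0_norm// (le_trans _ f'f)//.
  by rewrite ler_piMl.
Qed.

(** * The chain rule *)

Lemma relcomp_graph_on (X Y Z : Type) (S1 : X -> set Y) (S2 : Y -> set Z)
    (Omega : set X) :
  relcomp (graph_on S1 Omega) (graph S2) = graph_on (mcomp S2 S1) Omega.
Proof.
apply/seteqP; split=> [[x z] [y [[Ox S1xy] S2yz]]|[x z] [Ox [y S1xy S2yz]]].
  by split=> //; exists y.
by exists y.
Qed.

Lemma duality_tangent0 (R : realType) (X : normedModType R) (Omega : set X) x :
  Omega x -> duality_image (tangent_cone Omega x) 0.
Proof.
move=> Ox; exists 0; last by split; rewrite /= ?normr0 ?expr0n.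
exists harmonic, (fun=> 0); split=> [k| | |k].
- by rewrite invr_gt0 ltr0n.
- exact: cvg_harmonic.
- exact: cvg_cst.
- by rewrite scaler0 addr0.
Qed.

Lemma harmonic_cvg (R : realType) : (fun k => k.+1%:R^-1 : R) @ \oo --> (0 : R).
Proof. exact: cvg_harmonic. Qed.

Lemma cvg_near (R : realType) (V : normedModType R) (u v : nat -> V) (l : V) :
  (forall k, `|u k - v k| <= k.+1%:R^-1) -> v @ \oo --> l -> u @ \oo --> l.
Proof. by move=> uv; exact: (cvg0_dist uv (@harmonic_cvg R)). Qed.

Section composition.
Variables (R : realType) (X Y Z : completeNormedModType R).
Hypotheses (smX : frechet_smooth_norm X) (smY : frechet_smooth_norm Y).
Hypothesis rY : reflexive_space Y.
Variables (S1 : X -> set Y) (S2 : Y -> set Z) (Omega : set X).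
Hypotheses (Omega_closed : closed Omega) (Omega_convex : convex_set Omega).
Variables (xbar : X) (ybar : Y) (zbar : Z).
Hypothesis xy_graph : graph_on S1 Omega (xbar, ybar).
Hypothesis yz_graph : graph S2 (ybar, zbar).
Hypothesis S1_closed : locally_closed_at (graph S1) (xbar, ybar).
Hypothesis S2_closed : locally_closed_at (graph S2) (ybar, zbar).
Hypothesis G_isc : inner_semicontinuous (intermediate S1 S2) (Omega `*` setT)
             (xbar, zbar) ybar.

Lemma intermediate_sequence eps u fs gs :
  normal_sequence (graph_on (mcomp S2 S1) Omega) (xbar, zbar) eps u fs gs ->
  exists2 y : nat -> Y, y @ \oo --> ybar & forall k,
    graph_on S1 Omega ((u k).1, y k) /\ graph S2 (y k, (u k).2).
Proof.
move=> [_ Lu uw _]; have [|y yG yl] := G_isc _ uw.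
  move=> k; have [Ok [v S1v S2v]] := Lu k.
  by split; [exists v; split|split].
by exists y => // k; have [h1 h2] := yG k; split=> //; split=> //; exact: (Lu k).1.
Qed.

(** Weak* convergence bounds the functionals, which makes the normality errors absolute; then
    [fuzzy_relative] is applied at each index with tolerance 1/(k+1). *)
Lemma coderiv_fuzzy eps u fs gs xs zs :
  normal_sequence (graph_on (mcomp S2 S1) Omega) (xbar, zbar) eps u fs gs ->
  (forall k, duality_image (tangent_cone Omega (u k).1) (fs k)) ->
  weak_star_cvg fs xs -> weak_star_cvg gs zs ->
  exists (s : nat -> nat) (b : nat -> R) (w1 : nat -> X * Y)
    (w2 : nat -> Y * Z) (mu : nat -> R) (ks : nat -> dual Y) (fs' : nat -> dual X),
  [/\ {homo s : m n / (m < n)%N},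
      (forall k, 0 <= b k) /\ b @ \oo --> (0 : R),
      [/\ forall k, graph_on S1 Omega (w1 k), w1 @ \oo --> (xbar, ybar),
          forall k, graph S2 (w2 k) & w2 @ \oo --> (ybar, zbar)],
      (forall k, 0 <= mu k /\ mu k ^+ 2 + `|ks k| ^+ 2 = 1) /\
      (forall k, duality_image (tangent_cone Omega (w1 k).1) (fs' k)) &
      [/\ weak_star_cvg fs' xs,
          forall k, abs_normal (b k) (graph_on S1 Omega) (w1 k)
            (mu k *: fs' k) (- ks k) &
          forall k, abs_normal (b k) (graph S2) (w2 k) (ks k)
            (- (mu k *: gs (s k)))]].
Proof.
move=> nseq Jfs fsx gsz; have [y yl yG] := intermediate_sequence nseq.
have [[eps0 epsl] Lu ul epsN] := nseq.
have [M1 M10 fsM] := weak_star_bounded fsx.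
have [M2 M20 gsM] := weak_star_bounded gsz.
pose M := Num.max M1 M2.
have M0 : 0 <= M by rewrite le_max M10.
have aN k : abs_normal (4 * eps k * M) (relcomp (graph_on S1 Omega) (graph S2))
    (u k) (fs k) (- gs k).
  rewrite relcomp_graph_on; apply: abs_normal_of_eps (epsN k) => //.
    by rewrite (le_trans (fsM k))// le_max lexx.
  by rewrite normrN (le_trans (gsM k))// le_max lexx orbT.
have u1l : (fst \o u) @ \oo --> xbar by apply: (cvg_comp _ _ ul); exact: cvg_fst.
have u2l : (snd \o u) @ \oo --> zbar by apply: (cvg_comp _ _ ul); exact: cvg_snd.
pose v1 k := ((u k).1, y k); pose v2 k := (y k, (u k).2).
have v1l : v1 @ \oo --> (xbar, ybar) by exact: cvg_pair.
have v2l : v2 @ \oo --> (ybar, zbar) by exact: cvg_pair.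
have [r1 r10 r1P] := locally_closed_near (locally_closed_graph_on Omega_closed S1_closed).
have [r2 r20 r2P] := locally_closed_near S2_closed.
have [N1 N1P] := (cvgn_distP _ _).1 v1l _ r10.
have [N2 N2P] := (cvgn_distP _ _).1 v2l _ r20.
(* The shift skips the indices whose base points are not yet where local closedness is known. *)
pose s k := (k + maxn N1 N2)%N.
have s_incr : {homo s : m n / (m < n)%N} by move=> m n; rewrite ltn_add2r.
have [sN1 sN2] : (forall k, (N1 <= s k)%N) /\ (forall k, (N2 <= s k)%N).
  by split=> k; rewrite (leq_trans _ (leq_addl _ _))// leq_max leqnn ?orbT.
have b0 k : 0 <= 4 * eps k * M by rewrite !mulr_ge0.
have n0 k : (0 : R) < k.+1%:R^-1 by rewrite invr_gt0 ltr0n.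
have step k : exists t : (X * Y) * (Y * Z) * R * dual Y * dual X,
  let: (w1, w2, mu, kk, f') := t in
  [/\ graph_on S1 Omega w1 /\ graph S2 w2,
      `|w1 - v1 (s k)| <= k.+1%:R^-1 /\ `|w2 - v2 (s k)| <= k.+1%:R^-1,
      0 <= mu /\ mu ^+ 2 + `|kk| ^+ 2 = 1,
      duality_image (tangent_cone Omega w1.1) f' /\ `|f' - fs (s k)| <= k.+1%:R^-1 &
      abs_normal (4 * eps (s k) * M + k.+1%:R^-1) (graph_on S1 Omega) w1
        (mu *: f') (- kk) /\
      abs_normal (4 * eps (s k) * M + k.+1%:R^-1) (graph S2) w2
        kk (- (mu *: gs (s k)))].
  have aNk := aN (s k); rewrite [u (s k)]surjective_pairing in aNk.
  have [w1 [w2 [mu [kk [f' H]]]]] := fuzzy_relative smX smY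
    (@seq_complete_of_complete _ X) (@seq_complete_of_complete _ Y)
    (@seq_complete_of_complete _ Z) Omega_convex (yG (s k)).1 (yG (s k)).2
    (r1P _ (N1P _ (sN1 k))) (r2P _ (N2P _ (sN2 k))) (b0 (s k)) aNk (Jfs (s k)) (n0 k).
  by exists (w1, w2, mu, kk, f').
have [t tP] := choice step.
exists s, (fun k => 4 * eps (s k) * M + k.+1%:R^-1), (fun k => (t k).1.1.1.1),
  (fun k => (t k).1.1.1.2), (fun k => (t k).1.1.2), (fun k => (t k).1.2),
  (fun k => (t k).2).
have {}tP k := tP k.
split=> //.
- split; first by move=> k; rewrite addr_ge0// ltW.
  rewrite -[X in _ --> X]addr0; apply: cvgD; last exact: harmonic_cvg.
  rewrite -(mul0r M); apply: cvgMr_tmp; rewrite -(mulr0 4); apply: cvgMl_tmp.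
  exact: (@cvg_incr R R^o eps 0 s s_incr epsl).
- split.
  + by move=> k; have := tP k; case: (t k) => [[[[w1 w2] mu] kk] f'] [[]].
  + apply: (cvg_near _ (cvg_incr s_incr v1l)) => k.
    by have := tP k; case: (t k) => [[[[w1 w2] mu] kk] f'] [_ []].
  + by move=> k; have := tP k; case: (t k) => [[[[w1 w2] mu] kk] f'] [[]].
  + apply: (cvg_near _ (cvg_incr s_incr v2l)) => k.
    by have := tP k; case: (t k) => [[[[w1 w2] mu] kk] f'] [_ []].
- split=> k; have := tP k; case: (t k) => [[[[w1 w2] mu] kk] f'].
    by move=> [_ _].
  by move=> [_ _ _ []].
- split.
  + apply: (weak_star_dist _ (@harmonic_cvg R) (weak_star_incr s_incr fsx)) => k.
    by have := tP k; case: (t k) => [[[[w1 w2] mu] kk] f'] [_ _ _ []].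
  + by move=> k; have := tP k; case: (t k) => [[[[w1 w2] mu] kk] f'] [_ _ _ _ []].
  + by move=> k; have := tP k; case: (t k) => [[[[w1 w2] mu] kk] f'] [_ _ _ _ []].
Qed.

Hypothesis qc : psnc S2 (ybar, zbar) \/ mirror_psnc (minv S1) Omega (ybar, xbar).
Hypothesis trivial_intersection : mixed_coderiv S2 (ybar, zbar) 0 `&`
     (-%R @` mirror_coderiv (minv S1) Omega (ybar, xbar) 0) = [set 0].

(* The multiplier mu k of the original functionals cannot vanish in the limit:
   otherwise ks k would converge weakly* to an element of the trivial
   intersection, and PSNC would force norm convergence to 0. *)
Lemma multiplier_not_cvg0 (b : nat -> R) w1 w2 (mu : nat -> R) ks fs gs M :
  (forall k, 0 <= b k) -> b @ \oo --> (0 : R) ->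
  (forall k, graph_on S1 Omega (w1 k)) -> w1 @ \oo --> (xbar, ybar) ->
  (forall k, graph S2 (w2 k)) -> w2 @ \oo --> (ybar, zbar) ->
  (forall k, 0 <= mu k /\ mu k ^+ 2 + `|ks k| ^+ 2 = 1) ->
  (forall k, duality_image (tangent_cone Omega (w1 k).1) (fs k)) ->
  (forall k, `|fs k| <= M) -> (forall k, `|gs k| <= M) ->
  (forall k, abs_normal (b k) (graph_on S1 Omega) (w1 k) (mu k *: fs k) (- ks k)) ->
  (forall k, abs_normal (b k) (graph S2) (w2 k) (ks k) (- (mu k *: gs k))) ->
  ~ mu @ \oo --> (0 : R).
Proof.
move=> b0 bl Gw1 w1l Gw2 w2l muk Jfs fM gM N1 N2 mul0.
have ks1 k : `|ks k| <= 1.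
  rewrite -(@ler_pXn2r _ 2) ?nnegrE// expr1n -(muk k).2 lerDr sqr_ge0//.
have ks_n0 : ~ (fun k => `|ks k|) @ \oo --> (0 : R).
  move=> ksl; have : (fun k => mu k ^+ 2 + `|ks k| ^+ 2) @ \oo --> (0 * 0 + 0 * 0 : R).
    by apply: cvgD; apply: cvgM.
  have -> : (fun k => mu k ^+ 2 + `|ks k| ^+ 2) = (fun=> 1).
    by apply/funext => k; rewrite (muk k).2.
  move=> h; have : (1 : R) = 0 * 0 + 0 * 0.
    by apply: (cvg_unique (@Rhausdorff R) _ h); exact: cvg_cst.
  by rewrite mul0r addr0 => /eqP; rewrite oner_eq0.
(* By the normalization, [mu] and [ks] cannot both tend to 0. Where |ks| >= c, absolute errors
   become relative ones, for both graphs. *)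
have [//|[c [s1 [c0 s1i cs1]]]] := dichotomy (fun k => normr_ge0 (ks k)).
have [s2 [k0 [s2i k0l]]] := weak_star_seq_compact rY (fun k => ks1 (s1 k)).
pose s k := s1 (s2 k).
have si : {homo s : m n / (m < n)%N} by move=> m n mn; apply: s1i; exact: s2i.
have cs k : c <= `|ks (s k)| by exact: cs1.
have mul s' : {homo s' : m n / (m < n)%N} -> (fun k => mu (s' k) * M) @ \oo --> (0 : R).
  move=> s'i; rewrite -(mul0r M); apply: cvgMr_tmp.
  exact: (@cvg_incr R R^o mu 0 s' s'i mul0).
have mug : (fun k => mu (s k) *: gs (s k)) @ \oo --> (0 : dual Z).
  apply: (cvg0_dist _ (mul s si) (v := fun=> 0)); last exact: cvg_cst.
  by move=> k; rewrite subr0 normrZ (ger0_norm (muk _).1) ler_wpM2l// (muk _).1.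
have muf : (fun k => - (mu (s k) *: fs (s k))) @ \oo --> (0 : dual X).
  apply: (cvg0_dist _ (mul s si) (v := fun=> 0)); last exact: cvg_cst.
  by move=> k; rewrite subr0 normrN normrZ (ger0_norm (muk _).1) ler_wpM2l// (muk _).1.
have bsl : (b \o s) @ \oo --> (0 : R) by exact: (@cvg_incr R R^o b 0 s si bl).
have [e2 ns2] : exists e2, normal_sequence (graph S2) (ybar, zbar) e2 (w2 \o s)
    (ks \o s) (fun k => mu (s k) *: gs (s k)).
  apply: (@normal_sequence_of_abs _ _ _ (b \o s) c) => //.
  - by move=> k; exact: b0.
  - by move=> k; exact: Gw2.
  - exact: cvg_incr.
  - by move=> k; rewrite (le_trans (cs k))// (norm_fst_le (ks (s k), _)).
  - by move=> k; exact: N2.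
(* Exchanging coordinates turns normality to the graph of [S1] over [Omega] into mirror normality
   for [minv S1], with first component [- ks]. *)
pose w1' k := ((w1 (s k)).2, (w1 (s k)).1).
have [e1 ns1] : exists e1, normal_sequence (graph (restrict_range (minv S1) Omega))
    (ybar, xbar) e1 w1' (fun k => - ks (s k)) (fun k => - (mu (s k) *: fs (s k))).
  apply: (@normal_sequence_of_abs _ _ _ (b \o s) c) => //.
  - by move=> k; exact: b0.
  - by move=> k; have [] := Gw1 (s k).
  - apply: cvg_pair; apply: (cvg_comp _ _ (cvg_incr si w1l)).
      exact: cvg_snd.
    exact: cvg_fst.
  - by move=> k; rewrite (le_trans (cs k))// -normrN (norm_fst_le (- ks (s k), _)).
  - move=> k; rewrite opprK /=.
    have -> : graph (restrict_range (minv S1) Omega) =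
        [set p | graph_on S1 Omega (p.2, p.1)].
      by apply/seteqP; split=> p [].
    exact: abs_normal_swap.
have Jw1' k : duality_image (tangent_cone Omega (w1' k).2) (- - (mu (s k) *: fs (s k))).
  by rewrite opprK; apply: duality_tangentZ;
    [exact: (muk _).1|exact: (Gw1 _).1|exact: Jfs].
have Nk0l : weak_star_cvg (fun k => - ks (s k)) (- k0).
  by move=> x; apply: cvgN; exact: k0l.
have k00 : k0 = 0.
  suff : [set 0 : dual Y] k0 by [].
  rewrite -trivial_intersection; split.
    by exists e2, (w2 \o s), (ks \o s), (fun k => mu (s k) *: gs (s k)).
  exists (- k0); last by rewrite opprK.
  by exists e1, w1', (fun k => - ks (s k)), (fun k => - (mu (s k) *: fs (s k))).
(* Whichever map is PSNC, its normal sequence forces |ks| to 0 along [s], against the lower bound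
   [c]. *)
have ksl : (fun k => `|ks (s k)|) @ \oo --> (0 : R).
  case: qc => [P|P].
    by apply: P ns2 _ mug; rewrite -k00.
  have -> : (fun k => `|ks (s k)|) = (fun k => `|- ks (s k)|).
    by apply/funext => k; rewrite normrN.
  by apply: P ns1 Jw1' _ muf; rewrite -oppr0 -k00.
have [N /(_ N (leqnn _))] := (cvgn_distP ((fun k => `|ks (s k)|) : nat -> R^o) _).1
  ksl _ (divr_gt0 c0 (ltr0Sn _ 1)).
by have := cs N; rewrite subr0 normr_id; lra.
Qed.

(** Where mu >= c, division by [mu] gives functionals bounded by 1/c, and a weak* limit of them is
    the intermediate [k0]. The [Z] components are a subsequence of the original [gs], so either mode
    of convergence is inherited and both inclusions follow. *)
Lemma coderiv_chain eps u fs gs xs zs :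
  normal_sequence (graph_on (mcomp S2 S1) Omega) (xbar, zbar) eps u fs gs ->
  (forall k, duality_image (tangent_cone Omega (u k).1) (fs k)) ->
  weak_star_cvg fs xs -> weak_star_cvg gs zs ->
  exists (k0 : dual Y) (s : nat -> nat), {homo s : m n / (m < n)%N} /\
    conic_normal_coderiv S1 Omega (xbar, ybar) k0 xs /\
    (k0 = 0 /\ zs = 0 \/ exists eps' w ks,
      normal_sequence (graph S2) (ybar, zbar) eps' w ks (gs \o s) /\
      weak_star_cvg ks k0).
Proof.
move=> nseq Jfs fsx gsz.
have [s0 [b [w1 [w2 [mu [ks [fs'
  [s0i [b0 bl] [G1 w1l G2 w2l] [muk Jfs'] [fs'x N1 N2]]]]]]]]] :=
  coderiv_fuzzy nseq Jfs fsx gsz.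
have gsz' := weak_star_incr s0i gsz.
have [M1 M10 fsM] := weak_star_bounded fs'x.
have [M2 M20 gsM] := weak_star_bounded gsz'.
pose M := Num.max M1 M2.
have fM k : `|fs' k| <= M by rewrite (le_trans (fsM k))// le_max lexx.
have gM k : `|gs (s0 k)| <= M by rewrite (le_trans (gsM k))// le_max lexx orbT.
have mun0 := multiplier_not_cvg0 b0 bl G1 w1l G2 w2l muk Jfs' fM gM N1 N2.
have [//|[c [s1 [c0 s1i cs1]]]] := dichotomy (fun k => (muk k).1).
have ks1 k : `|ks k| <= 1.
  rewrite -(@ler_pXn2r _ 2) ?nnegrE// expr1n -(muk k).2 lerDr sqr_ge0//.
have mup k : 0 < mu (s1 k) by exact: lt_le_trans (cs1 k).
have muV k : (mu (s1 k))^-1 <= c^-1 by rewrite lef_pV2// posrE.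
have kM k : `|(mu (s1 k))^-1 *: ks (s1 k)| <= c^-1.
  rewrite normrZ gtr0_norm ?invr_gt0// -[leRHS]mulr1 ler_pM// invr_ge0.
  exact: (muk _).1.
have [s2 [k0 [s2i k0l]]] := weak_star_seq_compact rY kM.
pose s k := s1 (s2 k).
have si : {homo s : m n / (m < n)%N} by move=> m n mn; apply: s1i; exact: s2i.
have s0si : {homo (s0 \o s) : m n / (m < n)%N} by move=> m n mn; apply: s0i; exact: si.
pose kk k := (mu (s k))^-1 *: ks (s k).
pose b' k := c^-1 * b (s k).
have b'0 k : 0 <= b' k by rewrite mulr_ge0// invr_ge0 ltW.
have b'l : b' @ \oo --> (0 : R).
  rewrite -(mulr0 c^-1); apply: cvgMl_tmp.
  exact: (@cvg_incr R R^o b 0 s si bl).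
have N1' k : abs_normal (b' k) (graph_on S1 Omega) (w1 (s k)) (fs' (s k)) (- kk k).
  have muVp : 0 < (mu (s k))^-1 by rewrite invr_gt0; exact: mup.
  have := abs_normalZ muVp (N1 (s k)).
  rewrite scalerA mulVf ?gt_eqF ?mup// scale1r scalerN.
  by apply: abs_normal_le; apply: ler_wpM2r; [exact: b0|exact: muV].
have N2' k : abs_normal (b' k) (graph S2) (w2 (s k)) (kk k) (- gs (s0 (s k))).
  have muVp : 0 < (mu (s k))^-1 by rewrite invr_gt0; exact: mup.
  have := abs_normalZ muVp (N2 (s k)).
  rewrite scalerN scalerA mulVf ?gt_eqF ?mup// scale1r.
  by apply: abs_normal_le; apply: ler_wpM2r; [exact: b0|exact: muV].
have fs'sx : weak_star_cvg (fs' \o s) xs by exact: weak_star_incr.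
have gssz : weak_star_cvg (gs \o s0 \o s) zs by exact: (weak_star_incr si gsz').
have [t1 [e1 [t1i alt1]]] := normal_sequence_limit b'0 b'l (fun k => G1 (s k))
  xy_graph (cvg_incr si w1l) N1' fs'sx k0l.
have [t2 [e2 [t2i alt2]]] := normal_sequence_limit b'0 b'l (fun k => G2 (s k))
  yz_graph (cvg_incr si w2l) N2' k0l gssz.
(* Each graph has its own subsequence, [t1] or [t2]; only [t2] is recorded, since the convergence of
   [gs] along it is used later. *)
exists k0, (s0 \o s \o t2); split.
  by move=> m n mn; apply: s0si; exact: t2i.
split.
  case: alt1 => [ns|[-> ->]].
    exists e1, (w1 \o s \o t1), (fs' \o s \o t1), (kk \o t1); split=> //.
    - by move=> k; exact: Jfs'.
    - exact: (weak_star_incr t1i fs'sx).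
    - exact: (weak_star_incr t1i k0l).
  exists (fun=> 0), (fun=> (xbar, ybar)), (fun=> 0), (fun=> 0); split.
  - exact: normal_sequence0.
  - by move=> _; apply: duality_tangent0; exact: xy_graph.1.
  - by move=> x; apply: cvg_cst.
  - by move=> x; apply: cvg_cst.
case: alt2 => [ns|]; [right|by left].
exists e2, (w2 \o s \o t2), (kk \o t2); split=> //.
exact: (weak_star_incr t2i k0l).
Qed.

End composition.

(** * Strictly differentiable outer mappings *)

Section strict_derivative.
Variables (R : realType) (Y Z : normedModType R) (f : Y -> Z) (y : Y).
Hypothesis fy : strictly_differentiable f y.

Lemma diff_bounded : exists2 C, 0 <= C & forall h, `|'d f y h| <= C * `|h|.
Proof.
have /linear_boundedP[C [_ CP]] : bounded_near ('d f y) (nbhs (0 : Y)).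
  by apply/linear_bounded_continuous; exact: (diff_continuous fy.1).
exists (Num.max C 0 + 1); first by rewrite addr_ge0// le_max lexx orbT.
by apply: CP; rewrite (@le_lt_trans _ _ (Num.max C 0)) ?le_max ?lexx// ltrDl.
Qed.

Lemma derivative_adjoint_dist (g h : dual Z) C :
  (forall x, `|'d f y x| <= C * `|x|) -> 0 <= C ->
  `|derivative_adjoint fy g - derivative_adjoint fy h| <= C * `|g - h|.
Proof.
move=> CP C0; apply: dual_norm_le => x x1.
have -> : (derivative_adjoint fy g - derivative_adjoint fy h) x =
  (g - h) ('d f y x) by [].
rewrite (le_trans (dual_abs_le _ _))// mulrC ler_wpM2r//.
by rewrite (le_trans (CP x))// ler_piMr.
Qed.

Lemma strict_expansion e : 0 < e -> exists2 d, 0 < d & forall y1 y2,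
  `|y1 - y| <= d -> `|y2 - y| <= d ->
  `|f y1 - f y2 - 'd f y (y1 - y2)| <= e * `|y1 - y2|.
Proof.
move=> e0; have /cvgrPdist_le/(_ e e0)/nbhs_normP[d /= d0 dP] := fy.2.
exists (d / 2); first by rewrite divr_gt0.
move=> y1 y2 h1 h2.
have := dP (y1, y2); rewrite /= sub0r normrN normrM normfV !normr_id.
have -> : `|(y, y) - (y1, y2)| < d.
  rewrite -normrN opprB (@le_lt_trans _ _ (d / 2))//; first exact: norm_pair_le.
  by rewrite gtr_pMr// invf_lt1// ltr1n.
move=> /(_ isT); have [->|y12] := eqVneq y1 y2.
  by rewrite !subrr linear0 subrr !normr0 mulr0.
by rewrite ler_pdivrMr// normr_gt0 subr_eq0.
Qed.

End strict_derivative.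

(** Test normality to the composition at (u.1, f u.2), whose displacement is at most (C + 1)|u - w|
    because rho <= 1. Linearizing [f] inside [g] costs M rho |u - w|. *)
Lemma abs_normal_chain (R : realType) (X Y Z : normedModType R)
    (S1 : X -> set Y) (Omega : set X) (f : Y -> Z) (ybar : Y)
    (fy : strictly_differentiable f ybar) (C M b rho d : R)
    (w : X * Y) (p : dual X) (g : dual Z) :
  0 <= C -> (forall h, `|'d f ybar h| <= C * `|h|) ->
  0 < rho -> rho <= 1 -> 0 < d ->
  (forall y, `|y - w.2| <= d ->
     `|f y - f w.2 - 'd f ybar (y - w.2)| <= rho * `|y - w.2|) ->
  0 <= b -> `|g| <= M ->
  abs_normal b [set q | exists y, graph_on S1 Omega (q.1, y) /\ q.2 = f y]
    (w.1, f w.2) p (- g) ->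
  abs_normal (b * (C + 1) + M * rho) (graph_on S1 Omega) w p
    (- derivative_adjoint fy g).
Proof.
move=> C0 CP rho0 rho1 d0 wd b0 gM h e e0.
have C10 : 0 < C + 1 by rewrite ltr_wpDl.
have [d1 d10 d1P] := h (e / (C + 1)) (divr_gt0 e0 C10).
exists (Num.min d (d1 / (C + 1))); first by rewrite lt_min d0 divr_gt0.
move=> u Gu; rewrite le_min => /andP[ud ud1].
have n1 : `|u.1 - w.1| <= `|u - w| := norm_fst_le (u - w).
have n2 : `|u.2 - w.2| <= `|u - w| := norm_snd_le (u - w).
have fu := wd u.2 (le_trans n2 ud).
set A := 'd f ybar (u.2 - w.2) in fu.
have nA : `|A| <= C * `|u - w| by rewrite (le_trans (CP _))// ler_wpM2l.
have rn : rho * `|u.2 - w.2| <= rho * `|u - w| by rewrite ler_pM2l.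
have rn1 : rho * `|u - w| <= `|u - w| by rewrite ler_piMl.
have nf : `|f u.2 - f w.2| <= (C + 1) * `|u - w|.
  have := ler_normD (f u.2 - f w.2 - A) A; rewrite subrK; lra.
have nq : `|(u.1, f u.2) - (w.1, f w.2)| <= (C + 1) * `|u - w|.
  by apply: norm_pair_le => //=; rewrite (le_trans n1)// ler_peMl// lerDr.
have Gfu : exists y, graph_on S1 Omega (u.1, y) /\ f u.2 = f y.
  by exists u.2; rewrite -surjective_pairing.
have nq1 : `|(u.1, f u.2) - (w.1, f w.2)| <= d1.
  by rewrite (le_trans nq)// mulrC -ler_pdivlMr.
have hd : p (u.1 - w.1) - g (f u.2 - f w.2) <=
    (b + e / (C + 1)) * `|(u.1, f u.2) - (w.1, f w.2)|.
  exact: (d1P (u.1, f u.2) Gfu nq1).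
suff : p (u.1 - w.1) - g A <= (b * (C + 1) + M * rho + e) * `|u - w| by [].
have gA : g (f u.2 - f w.2) - g A <= M * (rho * `|u - w|).
  rewrite -linearB (le_trans (dual_ler _ _))// ler_pM// (le_trans fu)//.
have : (b + e / (C + 1)) * `|(u.1, f u.2) - (w.1, f w.2)| <=
    (b + e / (C + 1)) * ((C + 1) * `|u - w|).
  by rewrite ler_wpM2l// addr_ge0// divr_ge0// ltW.
have -> : (b + e / (C + 1)) * ((C + 1) * `|u - w|) =
    (b * (C + 1) + e) * `|u - w| by field; rewrite gt_eqF.
lra.
Qed.

Lemma coderiv_single_valued (R : realType) (X Y Z : completeNormedModType R)
    (S1 : X -> set Y) (S2 : Y -> set Z) (Omega : set X)
    (xbar : X) (ybar : Y) (zbar : Z) (f : Y -> Z)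
    (fy : strictly_differentiable f ybar) (zs : dual Z) :
  (forall y, S2 y = [set f y]) ->
  graph_on S1 Omega (xbar, ybar) ->
  inner_semicontinuous (intermediate S1 S2) (Omega `*` setT)
    (xbar, zbar) ybar ->
  conic_mixed_coderiv (mcomp S2 S1) Omega (xbar, zbar) zs `<=`
    conic_mixed_coderiv S1 Omega (xbar, ybar) (derivative_adjoint fy zs).
Proof.
move=> S2f xy_graph G_isc xs [eps [u [fs [gs [nseq Jfs fsx gsz]]]]].
have [y yl yG] := intermediate_sequence G_isc nseq.
have [[eps0 epsl] Lu ul epsN] := nseq.
have [M1 M10 fsM] := weak_star_bounded fsx.
have [M2 M20 gsM] := weak_star_bounded (cvg_weak_star gsz).
pose M := Num.max M1 M2.
have M0 : 0 <= M by rewrite le_max M10.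
have gM k : `|gs k| <= M by rewrite (le_trans (gsM k))// le_max lexx orbT.
have [C C0 CP] := diff_bounded fy.
have C10 : 0 < C + 1 by rewrite ltr_wpDl.
have M10' : 0 < M + 1 by rewrite ltr_wpDl.
have u2 k : (u k).2 = f (y k).
  by have [_] := yG k; rewrite /graph /= S2f.
have graphE : graph_on (mcomp S2 S1) Omega =
    [set q | exists y, graph_on S1 Omega (q.1, y) /\ q.2 = f y].
  rewrite -relcomp_graph_on; apply/seteqP.
  by split=> q [y' [h1 h2]]; exists y'; split=> //; move: h2; rewrite /graph /= S2f.
have aN k : abs_normal (4 * eps k * M)
    [set q | exists y, graph_on S1 Omega (q.1, y) /\ q.2 = f y]
    ((u k).1, f (y k)) (fs k) (- gs k).
  rewrite -graphE -u2 -surjective_pairing; apply: abs_normal_of_eps (epsN k) => //.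
    by rewrite (le_trans (fsM k))// le_max lexx.
  by rewrite normrN gM.
pose w k := ((u k).1, y k).
have wl : w @ \oo --> (xbar, ybar).
  by apply: cvg_pair => //; apply: (cvg_comp _ _ ul); exact: cvg_fst.
(* Each tolerance is reached only eventually, so a subsequence with tolerances 1/(j+1) is extracted
   afterwards. *)
have near_normal j : \forall k \near \oo, abs_normal j.+1%:R^-1 (graph_on S1 Omega)
    (w k) (fs k) (- derivative_adjoint fy (gs k)).
  have j0 : (0 : R) < j.+1%:R^-1 by rewrite invr_gt0 ltr0n.
  have j1 : (j.+1%:R^-1 : R) <= 1 by rewrite invf_le1 ?ltr0n// ler1n.
  move: (_^-1) j0 j1 => e e0 e1.
  have e20 : 0 < e / 2 by rewrite divr_gt0.
  (* This choice ensures both rho <= 1 and M rho <= e/2. *)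
  pose rho := e / 2 / (M + 1).
  have rho0 : 0 < rho by rewrite divr_gt0.
  have rho1 : rho <= 1 by rewrite ler_pdivrMr// mul1r; lra.
  have Mrho : M * rho <= e / 2.
    by rewrite /rho mulrCA ger_pMr// ler_pdivrMr// mul1r lerDl.
  have [d d0 dP] := strict_expansion fy rho0.
  have [N1 N1P] := (cvgn_distP _ _).1 yl _ (divr_gt0 d0 (ltr0Sn _ 1)).
  have bl : (fun k => 4 * eps k * M * (C + 1)) @ \oo --> (0 : R).
    rewrite -(mul0r (C + 1)); apply: cvgMr_tmp; rewrite -(mul0r M); apply: cvgMr_tmp.
    by rewrite -(mulr0 4); apply: cvgMl_tmp.
  have [N2 N2P] := (cvgn_distP ((fun k => 4 * eps k * M * (C + 1)) : nat -> R^o) _).1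
    bl _ e20.
  exists (maxn N1 N2) => // k /=; rewrite geq_max => /andP[k1 k2].
  have b0 : 0 <= 4 * eps k * M by rewrite !mulr_ge0.
  have bk : 4 * eps k * M * (C + 1) <= e / 2.
    by rewrite (le_trans (ler_norm _))//; have := N2P k k2; rewrite subr0.
  have d20 : 0 < d / 2 by rewrite divr_gt0.
  have yk := N1P k k1.
  apply: (@abs_normal_le _ _ _ (4 * eps k * M * (C + 1) + M * rho)); first lra.
  apply: (abs_normal_chain (w := w k) fy C0 CP rho0 rho1 d20 _ b0 (gM k) (aN k)).
  move=> y' y'd; apply: dP; last lra.
  have := ler_normD (y' - y k) (y k - ybar); rewrite addrA subrK /= in y'd *; lra.
have [s [si sP]] :=
  @free_filter_subseq \oo _ eventually_filter (fun _ h => h) near_normal.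
have adjl : (fun k => derivative_adjoint fy (gs (s k))) @ \oo -->
    derivative_adjoint fy zs.
  apply: (cvg0_dist _ _ (v := fun=> derivative_adjoint fy zs)
    (r := fun k => C * `|gs (s k) - zs|)); last exact: cvg_cst.
    by move=> k; exact: derivative_adjoint_dist.
  rewrite -(mulr0 C); apply: cvgMl_tmp.
  apply/(cvgn_distP ((fun k => `|gs (s k) - zs|) : nat -> R^o)) => e e0.
  have [N NP] := (cvgn_distP _ _).1 (cvg_incr si gsz) e e0.
  by exists N => n Nn; rewrite subr0 normr_id; exact: NP.
have h0 k : (0 : R) <= k.+1%:R^-1 by rewrite invr_ge0.
have [t [e [ti [ns|[xs0 adj0]]]]] := normal_sequence_limit h0 (@harmonic_cvg R)
  (fun k => (yG (s k)).1) xy_graph (cvg_incr si wl) sP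
  (weak_star_incr si fsx) (cvg_weak_star adjl).
  exists e, (w \o s \o t), (fs \o s \o t),
    (fun k => derivative_adjoint fy (gs (s (t k)))).
  split=> //.
  - by move=> k; exact: Jfs.
  - exact: (weak_star_incr ti (weak_star_incr si fsx)).
  - exact: (cvg_incr ti adjl).
rewrite xs0 adj0; exists (fun=> 0), (fun=> (xbar, ybar)), (fun=> 0), (fun=> 0); split.
- exact: normal_sequence0.
- by move=> _; apply: duality_tangent0; exact: xy_graph.1.
- by move=> x; apply: cvg_cst.
- exact: cvg_cst.
Qed.

Theorem theorem5p4 (R : realType) (X Y Z : completeNormedModType R)
  (hX : renormed_reflexive X) (hY : renormed_reflexive Y)
  (hZ : renormed_reflexive Z)
  (S1 : X -> set Y) (S2 : Y -> set Z) (Omega : set X)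
  (Omega_closed : closed Omega) (Omega_convex : convex_set Omega)
  (xbar : X) (ybar : Y) (zbar : Z)
  (hxz : graph_on (mcomp S2 S1) Omega (xbar, zbar))
  (hy : intermediate S1 S2 (xbar, zbar) ybar)
  (S1_closed : locally_closed_at (graph S1) (xbar, ybar))
  (S2_closed : locally_closed_at (graph S2) (ybar, zbar))
  (G_isc : inner_semicontinuous (intermediate S1 S2) (Omega `*` setT)
             (xbar, zbar) ybar) :
  (psnc S2 (ybar, zbar) \/ mirror_psnc (minv S1) Omega (ybar, xbar) ->
   mixed_coderiv S2 (ybar, zbar) 0 `&`
     (-%R @` mirror_coderiv (minv S1) Omega (ybar, xbar) 0) = [set 0] ->
   forall zs : dual Z,
     conic_mixed_coderiv (mcomp S2 S1) Omega (xbar, zbar) zs `<=`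
       mcomp (conic_normal_coderiv S1 Omega (xbar, ybar))
             (mixed_coderiv S2 (ybar, zbar)) zs /\
     conic_normal_coderiv (mcomp S2 S1) Omega (xbar, zbar) zs `<=`
       mcomp (conic_normal_coderiv S1 Omega (xbar, ybar))
             (normal_coderiv S2 (ybar, zbar)) zs) /\
  (forall (f : Y -> Z) (f_sd : strictly_differentiable f ybar),
   (forall y, S2 y = [set f y]) ->
   forall zs : dual Z,
     conic_mixed_coderiv (mcomp S2 S1) Omega (xbar, zbar) zs `<=`
       conic_mixed_coderiv S1 Omega (xbar, ybar) (derivative_adjoint f_sd zs)).
Proof.
have [_ _ _ smX] := hX; have [rY _ _ smY] := hY.
have xy : graph_on S1 Omega (xbar, ybar) by split; [exact: hxz.1|exact: hy.1].
have yz : graph S2 (ybar, zbar) by exact: hy.2.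
split=> [qc triv zs|f f_sd S2f zs]; last exact: coderiv_single_valued S2f xy G_isc.
split=> xs [eps [u [fs [gs [nseq Jfs fsx gsz]]]]].
  have [k0 [s [si [D1 [[k00 zs0]|[eps' [w [ks [ns ksl]]]]]]]]] :=
    coderiv_chain smX smY rY Omega_closed Omega_convex xy yz S1_closed
      S2_closed G_isc qc triv nseq Jfs fsx (cvg_weak_star gsz).
    (* When both limits vanish, the zero sequence at the base point is a witness. *)
    exists k0 => //; rewrite k00 zs0.
    exists (fun=> 0), (fun=> (ybar, zbar)), (fun=> 0), (fun=> 0); split.
    - exact: normal_sequence0.
    - by move=> x; apply: cvg_cst.
    - exact: cvg_cst.
  exists k0 => //; exists eps', w, ks, (gs \o s); split=> //; exact: cvg_incr.
have [k0 [s [si [D1 [[k00 zs0]|[eps' [w [ks [ns ksl]]]]]]]]] :=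
  coderiv_chain smX smY rY Omega_closed Omega_convex xy yz S1_closed
    S2_closed G_isc qc triv nseq Jfs fsx gsz.
  exists k0 => //; rewrite k00 zs0.
  exists (fun=> 0), (fun=> (ybar, zbar)), (fun=> 0), (fun=> 0); split.
  - exact: normal_sequence0.
  - by move=> x; apply: cvg_cst.
  - by move=> x; apply: cvg_cst.
by exists k0 => //; exists eps', w, ks, (gs \o s); split=> //; exact: weak_star_incr.
Qed.
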